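(* Let $X_\infty(t)=\sum_{k=1}^\infty X^{(k)}(t)$ be an infinite superposition of OU type processes satisfying condition (A) for all $p\ge 2$ and condition (B) (both stated in the context), with $\lambda_k=\lambda/k$ for some $\lambda>0$ and $\delta_k=k^{-(1+2(1-H))}$, $\frac12<H<1$. Let $S_\infty(t)=\sum_{i=1}^{[t]}X_\infty(i)$. Then the centered partial sum process $\{S_\infty(t)-\mathbb{E}S_\infty(t),\ t\ge0\}$ is intermittent.
   Context: Condition (A) (for a given $p\ge2$): $X^{(k)}(t)$, $k\ge1$, are independent stationary processes, each $X^{(k)}$ being the stationary solution of $dX^{(k)}(t)=-\lambda_kX^{(k)}(t)dt+dZ^{(k)}(\lambda_kt)$, $t\ge0$, i.e. $X^{(k)}(t)=e^{-\lambda_k t}X^{(k)}(0)+\int_0^t e^{-\lambda_k(t-s)}dZ^{(k)}(\lambda_k s)$ with $X^{(k)}(0)$ independent of $Z^{(k)}$, where the $Z^{(k)}$ are independent L\'evy processes and $\lambda_k>0$ for all $k$. The self-decomposable marginal distribution of $X^{(k)}$ has finite moments of order $p$, and the cumulants of orders $2,\dots,p$ of $X^{(k)}$ are proportional to some parameter $\delta_k$ of the distribution of $X^{(k)}$: the $m$-th cumulant of $X^{(k)}$ is $C_m\delta_k$, with $C_m$ not depending on $k$. The $m$-th cumulant of a random variable $X$ is $(-i)^m\frac{d^m}{dz^m}\log\mathbb{E}e^{izX}\big|_{z=0}$. Condition (B): $\sum_{k=1}^\infty\mathbb{E}X^{(k)}(t)<\infty$ and $\sum_{k=1}^\infty\operatorname{Var}X^{(k)}(t)<\infty$;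 under it the series defining $X_\infty$ is well defined (mean-square or almost-sure convergence). Intermittency: for a process $\{Y(t),t\ge0\}$ let $\overline q=\sup\{q>0:\mathbb{E}|Y(t)|^q<\infty\ \forall t\}$ and define the scaling function $\tau(q)=\lim_{t\to\infty}\frac{\log\mathbb{E}|Y(t)|^q}{\log t}$ for $q\in[0,\overline q)$, assuming the limit exists and is finite for every $q\in[0,\overline q)$. The process $Y$ is intermittent if there exist $p,r\in(0,\overline q)$, $p<r$, such that $\tau(p)/p<\tau(r)/r$. $[x]$ is the integer part of $x$.
   Formalization: The formal theorem adds the hypothesis that C_m is nonzero for some m ≥ 3, i.e. the X^(k) are not Gaussian or constant; for Gaussian OU processes (A) and (B) hold but τ(q) = Hq is linear, so the claim as stated fails. *)

(* Defs.v *)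
From HB Require Import structures.
From mathcomp Require Import all_boot all_order all_algebra.
From mathcomp Require Import complex.
From mathcomp Require Import all_classical all_reals all_analysis.
Set Implicit Arguments.
Unset Strict Implicit.
Unset Printing Implicit Defensive.
Import Order.TTheory GRing.Theory Num.Theory.
Import numFieldNormedType.Exports.
Local Open Scope classical_set_scope.
Local Open Scope ring_scope.

(* A stochastic process is a map [Y : R -> T -> R], [Y t w]; only the times
   [t >= 0] are ever constrained. *)

Section independence.
Context (d : measure_display) (T : measurableType d) (R : realType)
        (P : probability T R).

Definition independent_systems (I : eqType) (F : I -> set (set T)) :=
  forall (s : seq I) (A : I -> set T), uniq s ->
    (forall i, i \in s -> F i (A i)) ->
    P (\bigcap_(i in [set` s]) A i) = (\prod_(i <- s) P (A i))%E.

Definition independent2 (F G : set (set T)) :=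
  forall A B, F A -> G B -> P (A `&` B) = (P A * P B)%E.

Definition sigma_rv (X : T -> R) : set (set T) :=
  [set X @^-1` B | B in [set B : set R | measurable B]].

Definition sigma_process (Y : R -> T -> R) : set (set T) :=
  <<s \bigcup_(t in [set t : R | 0 <= t]) sigma_rv (Y t) >>.

Definition independent_processes (I : eqType) (Y : I -> R -> T -> R) :=
  independent_systems (fun i => sigma_process (Y i)).

Definition same_law (X Y : T -> R) :=
  forall B : set R, measurable B -> P (X @^-1` B) = P (Y @^-1` B).

End independence.

Section processes.
Context (d : measure_display) (T : measurableType d) (R : realType)
        (P : probability T R).

(* Strict stationarity: shift-invariance of the finite-dimensional
   distributions, tested on measurable rectangles. *)
Definition stationary (Y : R -> T -> R) :=
  forall (n : nat) (t : 'I_n -> R) (h : R) (B : 'I_n -> set R),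
    (forall i, 0 <= t i) -> 0 <= h -> (forall i, measurable (B i)) ->
    P [set w | forall i, B i (Y (t i + h) w)] =
    P [set w | forall i, B i (Y (t i) w)].

Definition cadlag (f : R -> R) :=
  (forall t, 0 <= t -> f s @[s --> t^'+] --> f t) /\
  (forall t, 0 < t -> cvg (f s @[s --> t^'-])).

Record levy_process (Z : R -> T -> R) : Prop := LevyProcess {
  levy_start0 : {ae P, forall w, Z 0 w = 0} ;
  levy_indep_increments : forall (n : nat) (t : nat -> R),
    0 <= t 0%N -> (forall i, t i <= t i.+1) ->
    independent_systems P
      (fun i : 'I_n => sigma_rv (fun w => Z (t i.+1) w - Z (t i) w)) ;
  levy_stationary_increments : forall s t, 0 <= s -> 0 <= t ->
    same_law P (fun w => Z (s + t) w - Z s w) (Z t) ;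
  levy_stochastic_continuity : forall s eps, 0 <= s -> 0 < eps ->
    P [set w | eps < `|Z t w - Z s w|]
      @[t --> within [set t : R | 0 <= t] (nbhs s)] --> 0%E ;
  levy_cadlag : {ae P, forall w, cadlag (Z ^~ w)} }.

(* [s 0 <= ... <= s n] is a partition of [a, b] of mesh less than [mesh],
   tagged by [xi]. *)
Definition tagged_partition (a b mesh : R) (n : nat) (s xi : nat -> R) :=
  [/\ s 0%N = a, s n = b &
      forall i, (i < n)%N ->
        [/\ s i <= xi i, xi i <= s i.+1 & s i.+1 - s i < mesh]].

(* [J] is the stochastic integral of the deterministic function [f] over [a, b]
   against [dZ]: the limit in probability of the Riemann-Stieltjes sums as the
   mesh tends to 0. *)
Definition is_stochastic_integral (f : R -> R) (a b : R) (Z : R -> T -> R)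
    (J : T -> R) :=
  forall eps eta : R, 0 < eps -> 0 < eta ->
    exists2 mesh : R, 0 < mesh &
      forall (n : nat) (s xi : nat -> R), tagged_partition a b mesh n s xi ->
      (P [set w | (eps < `|\sum_(0 <= i < n)
            f (xi i) * (Z (s i.+1) w - Z (s i) w) - J w|)%R] <= eta%:E)%E.

(* [X] is the stationary solution of
   [dX(t) = - lambda X(t) dt + dZ(lambda t)]. *)
Record stationary_OU (lambda : R) (Z X : R -> {RV P >-> R}) : Prop :=
  StationaryOU {
  OU_stationary : stationary X ;
  OU_indep_start : independent2 P (sigma_rv (X 0)) (sigma_process Z) ;
  OU_solution : forall t, 0 <= t ->
    exists2 J : {RV P >-> R},
      is_stochastic_integral (fun s => expR (- lambda * (t - s))) 0 t
        (fun s => Z (lambda * s)) J &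
      {ae P, forall w, X t w = expR (- lambda * t) * X 0 w + J w} }.

End processes.

Section laws.
Context (d : measure_display) (T : measurableType d) (R : realType)
        (P : probability T R).

(* The law of [X] is self-decomposable: for each [c] in ]0, 1[ it is the law of
   [c X + V] for some [V] (of law [rho]) independent of [X]. *)
Definition self_decomposable (X : {RV P >-> R}) :=
  forall c : R, 0 < c < 1 ->
    exists rho : probability (measurableTypeR R) R,
      forall B : set R, measurable B ->
        distribution P X B =
        (distribution P X \x rho)%E [set xy | B (c * xy.1 + xy.2)].

Definition char_fun (X : T -> R) (z : R) : R[i] :=
  (fine 'E_P[fun w => cos (z * X w)] +i* fine 'E_P[fun w => sin (z * X w)])%C.

(* The principal logarithm on the half-plane [Re u > 0], which contains the
   values of a characteristic function near 0; only the germ at 0 of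
   [clog \o char_fun X] is used. *)
Definition clog (u : R[i]) : R[i] :=
  (ln (Num.sqrt (complex.Re u ^+ 2 + complex.Im u ^+ 2))
   +i* atan (complex.Im u / complex.Re u))%C.

Definition cderive1n (m : nat) (f : R -> R[i]) (x : R) : R[i] :=
  (derive1n m (fun y => complex.Re (f y)) x
   +i* derive1n m (fun y => complex.Im (f y)) x)%C.

Definition cumulant (m : nat) (X : T -> R) : R[i] :=
  (- 'i%C) ^+ m * cderive1n m (fun z => clog (char_fun X z)) 0.

End laws.

Section superposition.
Context (d : measure_display) (T : measurableType d) (R : realType)
        (P : probability T R).

(* In all families indexed by [k : nat], index [k] stands for the
   [(k+1)]-st member of a sequence numbered from 1. *)

Record conditionA (lambda delta : nat -> R) (C : nat -> R)
    (Z X : nat -> R -> {RV P >-> R}) (p : nat) : Prop := ConditionA {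
  condA_lambda_gt0 : forall k, 0 < lambda k ;
  condA_levy : forall k, levy_process P (Z k) ;
  condA_levy_indep : independent_processes P Z ;
  condA_OU : forall k, stationary_OU (lambda k) (Z k) (X k) ;
  condA_OU_indep : independent_processes P X ;
  condA_self_decomposable : forall k,
    self_decomposable (X k 0) ;
  condA_moment : forall k, ('E_P[fun w => (`|X k 0%R w| ^+ p)%R] < +oo)%E ;
  condA_cumulant : forall k m, (2 <= m <= p)%N ->
    cumulant P m (X k 0) = (C m * delta k)%:C%C }.

Definition conditionB (X : nat -> R -> {RV P >-> R}) :=
  forall t, 0 <= t ->
    cvgn (series (fun k => fine 'E_P[X k t])) /\
    (\sum_(0 <= k <oo) 'V_P[X k t] < +oo)%E.

Definition is_superposition (X : nat -> R -> {RV P >-> R})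
    (Xinf : R -> {RV P >-> R}) :=
  forall t, 0 <= t ->
    {ae P, forall w, series (fun k => X k t w) n @[n --> \oo] --> Xinf t w}.

Definition partial_sum (X : R -> T -> R) (t : R) (w : T) : R :=
  \sum_(1 <= i < (Num.truncn t).+1) X i%:R w.

Definition centered (Y : R -> T -> R) (t : R) (w : T) : R :=
  Y t w - fine 'E_P[Y t].

End superposition.

Section intermittency.
Context (d : measure_display) (T : measurableType d) (R : realType)
        (P : probability T R).
Implicit Type Y : R -> T -> R.

Definition abs_moment Y (q t : R) : \bar R := 'E_P[fun w => `|Y t w| `^ q].

Definition qbar Y : \bar R :=
  ereal_sup [set q%:E | q in
    [set q : R | 0 < q /\ forall t, 0 <= t -> (abs_moment Y q t < +oo)%E]].

(* The scaling function of [Y] exists at [q] and has the finite value [l]. *)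
Definition scaling_at Y (q l : R) :=
  (lne (abs_moment Y q t) * ((ln t)^-1)%:E)%E @[t --> +oo%R] --> l%:E.

Definition scaling_function Y (tau : R -> R) :=
  forall q, 0 <= q -> (q%:E < qbar Y)%E -> scaling_at Y q (tau q).

(* The scaling function is only required to exist at the two exponents that
   are compared; [intermittentE] shows that this is the usual definition as
   soon as it exists on the whole of [0, qbar). *)
Definition intermittent Y :=
  exists p r taup taur : R,
    [/\ 0 < p < r, (r%:E < qbar Y)%E,
        scaling_at Y p taup, scaling_at Y r taur & taup / p < taur / r].

Lemma intermittentE Y (tau : R -> R) : scaling_function Y tau ->
  intermittent Y <->
  exists p r : R,
    [/\ 0 < p < r, (r%:E < qbar Y)%E & tau p / p < tau r / r].
Proof.
move=> tauY; split.
  move=> [p [r [tp [tr [/andP[p0 pr] rq tpE trE lt]]]]].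
  have r0 : 0 < r by exact: lt_trans pr.
  have pq : (p%:E < qbar Y)%E by apply: lt_trans rq; rewrite lte_fin.
  have tpP : tau p = tp.
    exact/EFin_inj/(cvg_unique (@ereal_hausdorff R) (tauY _ (ltW p0) pq) tpE).
  have trP : tau r = tr.
    exact/EFin_inj/(cvg_unique (@ereal_hausdorff R) (tauY _ (ltW r0) rq) trE).
  by exists p, r; rewrite p0 pr tpP trP.
move=> [p [r [/andP[p0 pr] rq lt]]].
have r0 : 0 < r by exact: lt_trans pr.
exists p, r, (tau p), (tau r); split; rewrite ?p0//.
  by apply: tauY (ltW p0) _; apply: lt_trans rq; rewrite lte_fin.
exact: tauY (ltW r0) rq.
Qed.

End intermittency.

(* Main.v *)
Require Import Defs.
From mathcomp Require Import all_boot all_order all_algebra.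
From mathcomp Require Import complex.
From mathcomp Require Import all_classical all_reals all_analysis.
From mathcomp Require Import measurable_realfun.
From mathcomp Require Import ring lra zify.
Set Implicit Arguments.
Unset Strict Implicit.
Unset Printing Implicit Defensive.
Import Order.TTheory GRing.Theory Num.Theory.
Import numFieldNormedType.Exports.
Local Open Scope classical_set_scope.
Local Open Scope ring_scope.

(** Put alpha = 2 (1 - H), so that 0 < alpha < 1, and let S(n) be the centered
    partial sum at an integer time n. The proof shows that for even M with
    C_M != 0 the moment of order M of S(n) lies, for large n, between two
    positive multiples of n^(M - alpha) ([even_limit_moment_bounds]). The scaling
    function then has the value M - alpha at M, and (M - alpha) / M = 1 - alpha / M
    increases with M, so that the exponents 2 and any even M >= 4 with C_M != 0
    witness intermittency, once C_2 != 0 ([intermittent_superposition]).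

    Cumulants carry the computation because they are additive over independent
    summands. They are defined by the derivatives at 0 of psi = log phi, where
    phi is the characteristic function. Differentiating phi' = psi' phi by the
    Leibniz rule gives the recursion
    mu_(n+1) = sum_j C(n, j) kappa_(j+1) mu_(n-j) between moments and cumulants
    ([are_cumulants_clog], [cumulantE]). Only this recursion is used afterwards;
    additivity is a statement about binomial convolutions ([alg_cumulantD]).

    For one process X, with rho = exp (- lambda), the solution formula reads
    X(1) + ... + X(n) = a X(0) + Y, where a = rho + ... + rho^n and Y is a sum of
    stochastic integrals, independent of X(0). By stationarity the sum of n + 1
    terms has the moments of X(0) + ... + X(n) = (1 + a) X(0) + Y. Hence passing
    from n to n + 1 adds ((1 + a)^m - a^m) kappa_m(X(0)) to the cumulant of order
    m: the contribution of Y, whatever it is, cancels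
    ([OU_partial_sum_cumulant]).

    Summed over k, the cumulant of order m >= 2 of S(n) is C_m times a sum of
    order n^(m - alpha) ([OU_weight_sum_le], [OU_weight_sum_ge]): a process with
    k >= n has hardly moved in time n, so that its n terms add up like n copies of
    a single variable and give n^m; the sum of k^(-1 - alpha) over k >= n is of
    order n^(- alpha); the processes with k < n contribute at most the same order.
    A moment of order m is the cumulant of order m plus products of at least two
    cumulants of total order m, and these are O(n^(m - 2 alpha))
    ([moments_le_of_cumulants]). The bounds hold uniformly in the number of
    processes that are summed, and moments of all orders pass to the limit
    ([moment_cvg]).

    It remains to find even orders with C_M != 0, given some m >= 3 with
    C_m != 0. If C_(2a) = 0, the moment of order 2a is only O(n^(2a - 2 alpha)),
    and 2 |y|^(a+b) <= s y^(2a) + y^(2b) / s with a good choice of s makes the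
    moment of order a + b too small for C_(a+b) != 0 ([cumulant_coef_eq0]).
    Applied to 2a = m + 1 and to 2a = 2 this gives an even order M >= 4 with
    C_M != 0, and then C_2 != 0. *)

(** * Cumulants as an operation on sequences of moments *)

Section binomial_convolution.
Variable R : comNzRingType.
Implicit Types a b c mu nu kap : nat -> R.

(** The product of exponential generating functions: if A and B are the series
    with coefficients a_n / n! and b_n / n!, then A B has the coefficients
    [bconv a b n] / n!. *)
Definition bconv a b (n : nat) : R :=
  \sum_(j < n.+1) 'C(n, j)%:R * a j * b (n - j)%N.

(** The derivative of the exponential generating function. *)
Definition shift a (n : nat) : R := a n.+1.

Lemma bconv0 a b : bconv a b 0%N = a 0%N * b 0%N.
Proof. by rewrite /bconv big_ord_recl big_ord0 addr0 bin0 mul1r. Qed.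

(** The product rule, in the form of Pascal's triangle. The identities of the
    algebra of generating functions follow from it by induction on the index. *)
Lemma bconvS a b n :
  bconv a b n.+1 = bconv (shift a) b n + bconv a (shift b) n.
Proof.
rewrite {1}/bconv big_ord_recl /= bin0 mul1r subn0.
under eq_bigr => i _ do rewrite /bump leq0n add1n binS natrD mulrDl mulrDl subSS.
rewrite big_split /= addrA addrC; congr (_ + _).
rewrite big_ord_recr /= bin_small // !mul0r addr0.
rewrite {1}/bconv big_ord_recl /= bin0 mul1r subn0 /shift; congr (_ + _).
by apply: eq_bigr => i _; rewrite /bump leq0n add1n subnSK.
Qed.

Lemma eq_bconv n a a' b b' : (forall j, (j <= n)%N -> a j = a' j) ->
  (forall j, (j <= n)%N -> b j = b' j) -> bconv a b n = bconv a' b' n.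
Proof.
move=> aa bb; apply: eq_bigr => j _.
by rewrite aa ?bb ?leq_subr // -ltnS.
Qed.

Lemma bconvDl a b c n :
  bconv (fun j => a j + b j) c n = bconv a c n + bconv b c n.
Proof.
by rewrite -big_split; apply: eq_bigr => j _; rewrite mulrDr mulrDl.
Qed.

Lemma bconvDr a b c n :
  bconv a (fun j => b j + c j) n = bconv a b n + bconv a c n.
Proof. by rewrite -big_split; apply: eq_bigr => j _; rewrite mulrDr. Qed.

Lemma bconvC a b n : bconv a b n = bconv b a n.
Proof.
elim: n a b => [|n IH] a b; first by rewrite !bconv0 mulrC.
by rewrite !bconvS addrC (IH a) (IH _ b).
Qed.

(** By [bconvS] both sides have the same derivative and the same value at 0. *)
Lemma bconvA a b c n : bconv (bconv a b) c n = bconv a (bconv b c) n.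
Proof.
elim: n a b c => [|n IH] a b c; first by rewrite !bconv0 mulrA.
rewrite !bconvS (@eq_bconv _ (shift (bconv a b))
  (fun j => bconv (shift a) b j + bconv a (shift b) j) c c) //; last first.
  by move=> j _; rewrite /shift bconvS.
rewrite (@eq_bconv _ a a (shift (bconv b c))
  (fun j => bconv (shift b) c j + bconv b (shift c) j)) //; last first.
  by move=> j _; rewrite /shift bconvS.
by rewrite bconvDl bconvDr !IH addrA.
Qed.

(** The differential equation M' = K' M between the exponential generating
    functions M of [mu] and K of [kap]. With mu_0 = 1 it says that K is the
    logarithm of M up to a constant. *)
Definition are_cumulants kap mu :=
  forall n, mu n.+1 = bconv (shift kap) mu n.

(** In the recursion [are_cumulants] for mu_n, the term of highest index is
    kap_n mu_0 = kap_n, so that kap_1, kap_2, ... can be computed one after the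
    other. Entry 0 of the list is kap_1. *)
Fixpoint cumulant_list mu (n : nat) : seq R :=
  if n is n'.+1 then
    let s := cumulant_list mu n' in
    rcons s (mu n - \sum_(j < n') 'C(n', j)%:R * s`_j * mu (n' - j)%N)
  else [::].

Definition alg_cumulant mu (n : nat) : R := (cumulant_list mu n)`_n.-1.

Lemma size_cumulant_list mu n : size (cumulant_list mu n) = n.
Proof. by elim: n => //= n IH; rewrite size_rcons IH. Qed.

Lemma nth_cumulant_list mu n j : (j < n)%N ->
  (cumulant_list mu n)`_j = alg_cumulant mu j.+1.
Proof.
elim: n => //= n IH; rewrite ltnS leq_eqVlt => /orP[/eqP -> //|jn].
by rewrite nth_rcons size_cumulant_list jn IH.
Qed.

(** The cumulants up to order [m] depend on the moments up to order [m] only. *)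
Lemma are_cumulants_unique kap kap' mu mu' m : mu 0%N = 1 ->
  are_cumulants kap mu -> are_cumulants kap' mu' ->
  (forall j, (j <= m)%N -> mu j = mu' j) ->
  (0 < m)%N -> kap m = kap' m.
Proof.
move=> mu0 H H'; elim/ltn_ind: m => -[//|m] IH mm _.
have := H m; rewrite mm// H' /bconv !big_ord_recr /= binn subnn mul1r.
rewrite /shift -mm// mu0 !mul1r !mulr1.
rewrite [X in X + _ = _](@eq_bigr _ _ _ _ _ _ _
   (fun i : 'I_m => 'C(m, i)%:R * kap i.+1 * mu (m - i)%N)) => [/addrI-> //|].
move=> i _; rewrite mm ?(leq_trans (leq_subr _ _))// -IH// ?ltnS//.
by move=> j ji; apply: mm; rewrite (leq_trans ji)// ltnW// ltnS.
Qed.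

Lemma alg_cumulantP mu : mu 0%N = 1 -> are_cumulants (alg_cumulant mu) mu.
Proof.
move=> mu0 n; rewrite /bconv big_ord_recr /= binn subnn mul1r mu0 mulr1.
rewrite {2}/shift /alg_cumulant /= nth_rcons size_cumulant_list ltnn eqxx.
rewrite [X in _ = X + _](_ : _ = \sum_(j < n) 'C(n, j)%:R *
  (cumulant_list mu n)`_j * mu (n - j)%N); last first.
  by apply: eq_bigr => j _; rewrite nth_cumulant_list.
by rewrite addrC subrK.
Qed.

Lemma alg_cumulantE kap mu m : mu 0%N = 1 -> are_cumulants kap mu -> (0 < m)%N ->
  alg_cumulant mu m = kap m.
Proof.
by move=> mu0 H m0; apply: (are_cumulants_unique mu0 (alg_cumulantP mu0) H).
Qed.

Lemma eq_alg_cumulant mu nu m : mu 0%N = 1 ->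
  (forall j, (j <= m)%N -> mu j = nu j) -> (0 < m)%N ->
  alg_cumulant mu m = alg_cumulant nu m.
Proof.
move=> mu0 mn m0; apply: (are_cumulants_unique mu0 (alg_cumulantP mu0) _ mn m0).
by apply: alg_cumulantP; rewrite -mn.
Qed.

(** The logarithm of a product: (M N)' = M' N + M N' = (K' + L') M N if M' = K' M
    and N' = L' N. *)
Lemma alg_cumulantD mu nu m : mu 0%N = 1 -> nu 0%N = 1 -> (0 < m)%N ->
  alg_cumulant (bconv mu nu) m = alg_cumulant mu m + alg_cumulant nu m.
Proof.
move=> mu0 nu0 m0.
apply: (alg_cumulantE (kap := fun m => alg_cumulant mu m + alg_cumulant nu m)) => //.
  by rewrite bconv0 mu0 nu0 mulr1.
move=> n; rewrite bconvS /shift bconvDl; congr (_ + _).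
  rewrite -bconvA; apply: eq_bconv => // j _; exact: alg_cumulantP.
rewrite bconvC (eq_bconv (a' := bconv (shift (alg_cumulant nu)) nu) (b' := mu)) //.
  by rewrite bconvA; apply: eq_bconv => // j _; rewrite bconvC.
by move=> j _; apply: alg_cumulantP.
Qed.

Lemma are_cumulantsZ x kap mu : are_cumulants kap mu ->
  are_cumulants (fun n => x ^+ n * kap n) (fun n => x ^+ n * mu n).
Proof.
move=> H n; rewrite H /bconv mulr_sumr; apply: eq_bigr => j _; rewrite /shift.
have -> : x ^+ n.+1 = x ^+ j.+1 * x ^+ (n - j).
  by rewrite -exprD addSn subnKC // -ltnS.
ring.
Qed.

Lemma alg_cumulantZ mu x m : mu 0%N = 1 -> (0 < m)%N ->
  alg_cumulant (fun j => x ^+ j * mu j) m = x ^+ m * alg_cumulant mu m.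
Proof.
move=> mu0 m0.
apply: (alg_cumulantE (kap := fun m => x ^+ m * alg_cumulant mu m)) => //.
  by rewrite mul1r.
exact: are_cumulantsZ (alg_cumulantP mu0).
Qed.

(** The moments of the constant [x], whose generating function has the logarithm
    x z. *)
Lemma alg_cumulant_exp x m : (1 < m)%N -> alg_cumulant (fun j => x ^+ j) m = 0.
Proof.
move=> m1.
rewrite (alg_cumulantE (kap := fun m => if m == 1%N then x else 0)) ?(ltnW m1)//.
  by case: eqP m1 => // ->.
move=> n; rewrite /bconv big_ord_recl big1 ?addr0 /=.
  by rewrite bin0 mul1r subn0 /shift eqxx exprS.
by move=> i _; rewrite /shift /= mulr0 mul0r.
Qed.

End binomial_convolution.

(** * Derivatives of the logarithm of a complex germ *)

Local Notation "f ^` ()" := (derive1 f) : ring_scope.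
Local Notation "f ^` ( n )" := (derive1n n f) : ring_scope.

Section real_derivative_rules.
Variable R : realType.
Implicit Types (f g : R -> R) (z : R).

Definition derivable1 f z : Prop := derivable f z 1.

Lemma derivable1D f g z : derivable1 f z -> derivable1 g z ->
  derivable1 (fun y => f y + g y) z.
Proof. exact: derivableD. Qed.

Lemma derive1D f g z : derivable1 f z -> derivable1 g z ->
  (fun y => f y + g y)^`() z = f^`() z + g^`() z.
Proof. by move=> df dg; rewrite !derive1E; exact: deriveD. Qed.

Lemma derivable1M f g z : derivable1 f z -> derivable1 g z ->
  derivable1 (fun y => f y * g y) z.
Proof. exact: derivableM. Qed.

Lemma derive1M f g z : derivable1 f z -> derivable1 g z ->
  (fun y => f y * g y)^`() z = f^`() z * g z + f z * g^`() z.
Proof.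
move=> df dg; rewrite !derive1E; apply: etrans (deriveM df dg) _.
by rewrite addrC [g z *: _]mulrC.
Qed.

Lemma derivable1V f z : f z != 0 -> derivable1 f z ->
  derivable1 (fun y => (f y)^-1) z.
Proof. exact: derivableV. Qed.

Lemma derive1V f z : f z != 0 -> derivable1 f z ->
  (fun y => (f y)^-1)^`() z = - (f^`() z * ((f z)^-1 * (f z)^-1)).
Proof.
move=> f0 df; rewrite !derive1E; apply: etrans (deriveV f0 df) _.
by rewrite expr2 invfM /GRing.scale /= mulNr mulrC.
Qed.

Lemma derive1_ln f z : 0 < f z -> derivable1 f z ->
  (@ln R \o f)^`() z = (f z)^-1 * f^`() z.
Proof.
move=> f0 df; have [dl lE] := is_derive1_ln f0.
by rewrite (derive1_comp df dl) derive1E lE.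
Qed.

Lemma derive1_atan f z : derivable1 f z ->
  (@atan R \o f)^`() z = (1 + f z ^+ 2)^-1 * f^`() z.
Proof.
move=> df; have [da aE] := is_derive1_atan (f z).
by rewrite (derive1_comp df da) derive1E aE.
Qed.

End real_derivative_rules.

Section smooth_germs.
Variable R : realType.
Implicit Types (f g : R -> R) (x : R) (n : nat).

(** The derivatives are asked to exist on a neighbourhood of [x] and not only at
    [x], and the notion depends on the germ of [f] at [x] alone ([eq_smooth]): the
    logarithm of a characteristic function is regular near 0 only. *)
Fixpoint smooth n f x : Prop :=
  if n is n'.+1 then (\forall z \near x, derivable1 f z) /\ smooth n' f^`() x
  else True.

Lemma near_derive1 f g x : {near x, f =1 g} -> {near x, f^`() =1 g^`()}.
Proof.
move=> /near_join; apply: filterS => z fg.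
by rewrite !derive1E; exact: near_eq_derive.
Qed.

Lemma eq_smooth n f g x : {near x, f =1 g} -> smooth n f x -> smooth n g x.
Proof.
elim: n f g => //= n IH f g fg [df sf]; split; last first.
  exact: IH (near_derive1 fg) sf.
move: df; apply: filterS2 (near_join fg) => z; exact: near_eq_derivable.
Qed.

Lemma near_derive1n n f g x : {near x, f =1 g} -> f^`(n) x = g^`(n) x.
Proof.
elim: n f g => [|n IH] f g fg; first exact: nbhs_singleton fg.
by rewrite !derive1Sn; apply: IH; exact: near_derive1.
Qed.

Lemma smoothW n f x : smooth n.+1 f x -> smooth n f x.
Proof. by elim: n f => // n IH f [df sf]; split => //; exact: IH. Qed.

Lemma near_derive1D f g x : (\forall z \near x, derivable1 f z) ->
  (\forall z \near x, derivable1 g z) ->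
  {near x, (fun z => f^`() z + g^`() z) =1 (fun z => f z + g z)^`()}.
Proof. by apply: filterS2 => z df dg; rewrite derive1D. Qed.

Lemma near_derive1M f g x : (\forall z \near x, derivable1 f z) ->
  (\forall z \near x, derivable1 g z) ->
  {near x, (fun z => f^`() z * g z + f z * g^`() z) =1 (fun z => f z * g z)^`()}.
Proof. by apply: filterS2 => z df dg; rewrite derive1M. Qed.

Lemma smoothD n f g x : smooth n f x -> smooth n g x ->
  smooth n (fun z => f z + g z) x.
Proof.
elim: n f g => //= n IH f g [df sf] [dg sg]; split.
  by move: df dg; apply: filterS2 => z; exact: derivable1D.
exact: eq_smooth (near_derive1D df dg) (IH _ _ sf sg).
Qed.

Lemma smoothM n f g x : smooth n f x -> smooth n g x ->
  smooth n (fun z => f z * g z) x.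
Proof.
elim: n f g => //= n IH f g [df sf] [dg sg]; split.
  by move: df dg; apply: filterS2 => z; exact: derivable1M.
have sf' : smooth n f x by apply: smoothW; split.
have sg' : smooth n g x by apply: smoothW; split.
apply: eq_smooth (near_derive1M df dg) _.
exact: smoothD (IH _ _ sf sg') (IH _ _ sf' sg).
Qed.

Lemma smooth_cst n (c : R) x : smooth n (fun=> c) x.
Proof.
elim: n c => //= n IH c; split; first by apply: filterE => z; exact: derivable_cst.
rewrite (_ : _^`() = fun=> 0); first exact: IH.
by apply/funext => z; rewrite derive1_cst.
Qed.

Lemma smoothN n f x : smooth n f x -> smooth n (fun z => - f z) x.
Proof.
move=> sf; rewrite (_ : (fun _ => _) = fun z => (-1) * f z); last first.
  by apply/funext => z; rewrite mulN1r.
exact: smoothM (smooth_cst _ _ _) sf.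
Qed.

Lemma smoothV n f x : (\forall z \near x, f z != 0) -> smooth n f x ->
  smooth n (fun z => (f z)^-1) x.
Proof.
move=> f0; elim: n => //= n IH [df sf]; split.
  by move: f0 df; apply: filterS2 => z; exact: derivable1V.
have sV : smooth n (fun z => (f z)^-1) x.
  by apply: IH; apply: smoothW; split.
apply: (eq_smooth (f := fun z => - (f^`() z * ((f z)^-1 * (f z)^-1)))).
  by move: f0 df; apply: filterS2 => z f0 df; rewrite derive1V.
exact: smoothN (smoothM sf (smoothM sV sV)).
Qed.

Lemma derive1nD n f g x : smooth n f x -> smooth n g x ->
  (fun z => f z + g z)^`(n) x = f^`(n) x + g^`(n) x.
Proof.
elim: n f g => // n IH f g [df sf] [dg sg].
rewrite !derive1Sn -IH//; apply/esym/near_derive1n; exact: near_derive1D.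
Qed.

(** Leibniz rule: one more application of the product rule is [bconvS]. *)
Lemma derive1nM n f g x : smooth n f x -> smooth n g x ->
  (fun z => f z * g z)^`(n) x =
  bconv (fun j => f^`(j) x) (fun j => g^`(j) x) n.
Proof.
elim: n f g => [f g _ _|n IH f g sf sg]; first by rewrite bconv0.
have [[df sf'] [dg sg']] := (sf, sg).
rewrite derive1Sn -(near_derive1n _ (near_derive1M df dg)) derive1nD.
- rewrite !IH//; [|exact: smoothW..].
  by rewrite bconvS; congr (_ + _); apply: eq_bconv => // j _; rewrite -derive1Sn.
- by apply: smoothM => //; exact: smoothW.
- by apply: smoothM => //; exact: smoothW.
Qed.

Lemma derive1nN n f x : smooth n f x -> (fun z => - f z)^`(n) x = - f^`(n) x.
Proof.
move=> sf; apply/eqP; rewrite -addr_eq0 -derive1nD//; last exact: smoothN.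
rewrite (_ : (fun _ => _) = cst 0); last by apply/funext => z; rewrite addNr.
apply/eqP; elim: n {sf} => // n IH.
rewrite derive1Sn (_ : _^`() = cst 0)//.
by apply/funext => z; rewrite derive1_cst.
Qed.

End smooth_germs.

Section logarithm_of_a_germ.
Variable R : realType.
Variables f g : R -> R.
Hypothesis f0 : f 0 = 1.
Hypothesis sf : forall n, smooth n f 0.
Hypothesis sg : forall n, smooth n g 0.

Let phi z : R[i] := (f z +i* g z)%C.

(** The components of the logarithm are a = log |phi| and b = arg phi, and
    q = |phi|^2. Near 0, a' + i b' = phi' conj(phi) / |phi|^2, which gives back
    phi' = (a' + i b') phi. *)
Let a z := complex.Re (clog (phi z)).
Let b z := complex.Im (clog (phi z)).
Let q z := f z * f z + g z * g z.

Let f_gt0 : \forall z \near 0, 0 < f z.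
Proof.
have df : derivable f 0 1 := nbhs_singleton (sf 1).1.
have /derivable1_diffP/differentiable_continuous cf := df.
by move: cf => /cvgr_gt; apply; rewrite f0.
Qed.

Let near_a : {near 0, (fun z => (f z * f^`() z + g z * g^`() z) * (q z)^-1) =1 a^`()}.
Proof.
apply: filterS3 f_gt0 (sf 1).1 (sg 1).1 => z fz df dg.
have qz : 0 < q z by rewrite ltr_wpDr ?mulr_gt0// -expr2 sqr_ge0.
have aE : a = fun y => 2^-1 * (@ln R \o q) y.
  apply/funext => y.
  by rewrite /a /= -powR12_sqrt ?addr_ge0 ?sqr_ge0// ln_powR !expr2.
have dff := derivable1M df df; have dgg := derivable1M dg dg.
have dq : derivable1 q z := derivable1D dff dgg.
have q'E : q^`() z = (f z * f^`() z + g z * g^`() z) *+ 2.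
  by rewrite /q (derive1D dff dgg) (derive1M df df) (derive1M dg dg); ring.
have dlq : derivable1 (@ln R \o q) z.
  by have [dl _] := is_derive1_comp (is_derive1_ln qz) (derivableP dq).
rewrite aE [RHS](derive1Ml _ dlq) derive1_ln// q'E -mulr_natr.
by field; rewrite gt_eqF.
Qed.

Let near_b : {near 0, (fun z => (g^`() z * f z - f^`() z * g z) * (q z)^-1) =1 b^`()}.
Proof.
apply: filterS3 f_gt0 (sf 1).1 (sg 1).1 => z fz df dg.
have fz0 : f z != 0 by rewrite gt_eqF.
have bE : b = atan \o (fun y => g y * (f y)^-1) by [].
have dv := derivable1V fz0 df.
rewrite bE derive1_atan; last exact: derivable1M.
rewrite (derive1M dg dv) derive1V// /q; field.
by rewrite fz0 lt0r_neq0// ltr_wpDr ?sqr_ge0// exprn_gt0.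
Qed.

Let q_neq0 : \forall z \near 0, q z != 0.
Proof.
apply: filterS f_gt0 => z fz.
by rewrite gt_eqF// ltr_wpDr ?mulr_gt0// -expr2 sqr_ge0.
Qed.

Let sa n : smooth n a^`() 0.
Proof.
have [_ df] := sf n.+1; have [_ dg] := sg n.+1.
apply: eq_smooth near_a _; apply: smoothM.
  by apply: smoothD; exact: smoothM.
by apply: (smoothV q_neq0); apply: smoothD; exact: smoothM.
Qed.

Let sb n : smooth n b^`() 0.
Proof.
have [_ df] := sf n.+1; have [_ dg] := sg n.+1.
apply: eq_smooth near_b _; apply: smoothM.
  apply: smoothD; last apply: smoothN;
    exact: smoothM.
by apply: (smoothV q_neq0); apply: smoothD; exact: smoothM.
Qed.

Let f'E : {near 0, (fun z => a^`() z * f z + - (b^`() z * g z)) =1 f^`()}.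
Proof.
near=> z; rewrite -(near near_a z)// -(near near_b z)//.
by rewrite /q; field; near: z; exact: q_neq0.
Unshelve. all: by end_near. Qed.

Let g'E : {near 0, (fun z => a^`() z * g z + b^`() z * f z) =1 g^`()}.
Proof.
near=> z; rewrite -(near near_a z)// -(near near_b z)//.
by rewrite /q; field; near: z; exact: q_neq0.
Unshelve. all: by end_near. Qed.

(** With psi the logarithm of phi, phi' = psi' phi near 0. The Leibniz rule for
    the derivative of order [n] of this equation at 0 is the recursion between
    moments and cumulants. *)
Lemma are_cumulants_clog :
  are_cumulants (fun n => cderive1n n (fun z => clog (phi z)) 0)
    (fun n => (f^`(n) 0 +i* g^`(n) 0)%C).
Proof.
move=> n; rewrite !derive1Sn -(near_derive1n _ f'E) -(near_derive1n _ g'E).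
rewrite !derive1nD ?derive1nN ?derive1nM//;
  do ?[exact: smoothN|exact: smoothM|apply: smoothN; exact: smoothM].
have ReD : {morph @complex.Re R : x y / x + y} by move=> [? ?] [? ?].
have ImD : {morph @complex.Im R : x y / x + y} by move=> [? ?] [? ?].
have E (j : nat) (u v : R[i]) : 'C(n, j)%:R * u * v =
  ('C(n, j)%:R * (complex.Re u * complex.Re v - complex.Im u * complex.Im v)
   +i* ('C(n, j)%:R * (complex.Re u * complex.Im v + complex.Im u * complex.Re v)))%C.
  rewrite -(rmorph_nat (real_complex R)); case: u v => [? ?] [? ?].
  by apply/eqP; rewrite eq_complex /=; apply/andP; split; apply/eqP; ring.
apply/eqP; rewrite eq_complex; apply/andP; split; apply/eqP => /=.
  rewrite /bconv (big_morph _ ReD (erefl : complex.Re (0 : R[i]) = 0)) -sumrB.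
  apply: eq_bigr => j _; rewrite E /shift /cderive1n !derive1Sn /=; ring.
rewrite /bconv (big_morph _ ImD (erefl : complex.Im (0 : R[i]) = 0)) -big_split.
apply: eq_bigr => j _; rewrite E /shift /cderive1n !derive1Sn /=; ring.
Qed.

End logarithm_of_a_germ.

(** * Moments and the characteristic function *)

Section moments.
Context (d : measure_display) (T : measurableType d) (R : realType)
        (P : probability T R).
Implicit Types X Y : T -> R.

Definition moment X (m : nat) : R := \int[P]_w (X w ^+ m).

(** Integrability of all powers is stable under sums and scalings, so that no
    bookkeeping of the orders of finite moments is needed. *)
Definition all_moments X :=
  measurable_fun setT X /\
  forall m, P.-integrable setT (fun w => (X w ^+ m)%:E).

Lemma integrable_le X Y : measurable_fun setT X ->
  P.-integrable setT (EFin \o Y) -> (forall w, `|X w| <= Y w) ->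
  P.-integrable setT (EFin \o X).
Proof.
move=> mX iY XY; apply: le_integrable iY => //; first exact/measurable_EFinP.
by move=> w _ /=; rewrite lee_fin (le_trans (XY w))// ler_norm.
Qed.

Lemma integrable_addr X Y : P.-integrable setT (EFin \o X) ->
  P.-integrable setT (EFin \o Y) ->
  P.-integrable setT (EFin \o (fun w => X w + Y w)).
Proof.
move=> iX iY; rewrite (_ : EFin \o _ = (EFin \o X) \+ (EFin \o Y))%E//.
exact: integrableD.
Qed.

Lemma integrable_mulr X (c : R) : P.-integrable setT (EFin \o X) ->
  P.-integrable setT (EFin \o (fun w => c * X w)).
Proof.
move=> iX; rewrite (_ : EFin \o _ = fun w => (c%:E * (EFin \o X) w)%E)//.
exact: integrableZl.
Qed.

Lemma Rintegral_cst1 (c : R) : \int[P]_w c = c.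
Proof. by rewrite /Rintegral/= integral_cst//= probability_setT mule1. Qed.

Lemma moment0 X : moment X 0 = 1.
Proof.
rewrite /moment; under eq_Rintegral do rewrite expr0.
exact: Rintegral_cst1.
Qed.

Lemma integrable_cst (c : R) : P.-integrable setT (fun=> c%:E).
Proof. exact: finite_measure_integrable_cst. Qed.

Lemma all_moments_cst (c : R) : all_moments (fun=> c).
Proof. by split => // m; exact: integrable_cst. Qed.

Lemma moment_cst (c : R) m : moment (fun=> c) m = c ^+ m.
Proof. by rewrite /moment Rintegral_cst1. Qed.

Lemma all_moments_norm X m : all_moments X ->
  P.-integrable setT (EFin \o (fun w => `|X w| ^+ m)).
Proof.
move=> [mX iX]; apply: eq_integrable (integrable_norm (iX m)) => // w _ /=.
by rewrite normrX.
Qed.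

Lemma all_momentsZ X (c : R) : all_moments X -> all_moments (fun w => c * X w).
Proof.
move=> [mX iX]; split => [|m]; first exact: measurable_funM.
under eq_fun do rewrite exprMn EFinM.
exact: integrableZl.
Qed.

Lemma moment_scale X (c : R) m : all_moments X ->
  moment (fun w => c * X w) m = c ^+ m * moment X m.
Proof.
move=> [mX iX]; rewrite /moment; under eq_Rintegral do rewrite exprMn.
by rewrite RintegralZl//; exact: iX.
Qed.

Lemma normr_exprD_le (x y : R) m :
  `|x + y| ^+ m <= 2 ^+ m * (`|x| ^+ m + `|y| ^+ m).
Proof.
wlog xy : x y / `|x| <= `|y|.
  move=> W; have [/W//|/ltW/W] := leP `|x| `|y|.
  by rewrite [x + y]addrC [_ ^+ m + _ ^+ m in X in _ -> X]addrC.
apply: (@le_trans _ _ ((2 * `|y|) ^+ m)).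
  apply: lerXn2r; rewrite ?nnegrE ?mulr_ge0//.
  by rewrite (le_trans (ler_normD _ _))// mulr_natl mulr2n lerD2r.
by rewrite exprMn ler_wpM2l ?exprn_ge0// lerDr exprn_ge0.
Qed.

Lemma all_momentsD X Y : all_moments X -> all_moments Y ->
  all_moments (fun w => X w + Y w).
Proof.
move=> hX hY; have [[mX iX] [mY iY]] := (hX, hY).
split => [|m]; first exact: measurable_funD.
apply: (integrable_le (Y := fun w => 2 ^+ m * (`|X w| ^+ m + `|Y w| ^+ m))).
- exact/measurable_funX/measurable_funD.
- by apply/integrable_mulr/integrable_addr; exact: all_moments_norm.
- by move=> w; rewrite normrX normr_exprD_le.
Qed.

Lemma all_moments_sum (I : Type) (s : seq I) (X : I -> T -> R) :
  (forall i, all_moments (X i)) -> all_moments (fun w => \sum_(i <- s) X i w).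
Proof.
move=> hX; elim: s => [|i s IH].
  by under eq_fun do rewrite big_nil; exact: all_moments_cst.
by under eq_fun do rewrite big_cons; exact: all_momentsD.
Qed.

Lemma all_moments_abs X : measurable_fun setT X ->
  (forall p, (2 <= p)%N -> ('E_P[fun w => (`|X w| ^+ p)%R] < +oo)%E) ->
  all_moments X.
Proof.
move=> mX hX; split => // m.
apply: (integrable_le (Y := fun w => 1 + `|X w| ^+ m.+2)).
- exact: measurable_funX.
- apply: integrable_addr; first exact: integrable_cst.
  apply/integrableP; split.
    by apply/measurable_EFinP/measurable_funX; exact: measurableT_comp.
  have := hX m.+2 isT; rewrite unlock; apply: le_lt_trans.
  rewrite le_eqVlt; apply/orP; left; apply/eqP; apply: eq_integral => w _ /=.
  by rewrite normrX normr_id.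
- move=> w; rewrite normrX; have [X1|/ltW X1] := leP `|X w| 1.
    apply: (@le_trans _ _ 1); first by rewrite exprn_ile1.
    by rewrite lerDl exprn_ge0.
  by apply: ler_wpDl => //; rewrite ler_weXn2l// -addn2 leq_addr.
Qed.

Section characteristic_function.
Variable X : T -> R.
Hypothesis hX : all_moments X.

(** Together with [sin_moment], the real and imaginary parts of
    E (X^n exp (i z X)); for n = 0 this is the characteristic function. *)
Definition cos_moment n z : R := \int[P]_w (X w ^+ n * cos (z * X w)).
Definition sin_moment n z : R := \int[P]_w (X w ^+ n * sin (z * X w)).

Lemma integrable_Xn_bounded n (h : R -> R) : measurable_fun setT h ->
  (forall x, `|h x| <= 1) ->
  P.-integrable setT (EFin \o (fun w => X w ^+ n * h (X w))).
Proof.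
have [mX iX] := hX.
move=> mh h1; apply: (integrable_le (Y := fun w => `|X w| ^+ n)).
- by apply: measurable_funM; [exact: measurable_funX|exact: measurableT_comp].
- exact: all_moments_norm.
- by move=> w; rewrite normrM normrX ler_piMr ?exprn_ge0.
Qed.

Lemma measurable_cosM (z : R) : measurable_fun setT (fun x : R => cos (z * x)).
Proof.
apply: measurableT_comp; last exact: measurable_funM.
apply: continuous_measurable_fun => x; exact: continuous_cos.
Qed.

Lemma measurable_sinM (z : R) : measurable_fun setT (fun x : R => sin (z * x)).
Proof.
apply: measurableT_comp; last exact: measurable_funM.
apply: continuous_measurable_fun => x; exact: continuous_sin.
Qed.

Lemma is_derive_cosM (c x z : R) :
  is_derive z 1 (fun z : R => c * cos (z * x)) (- (c * x * sin (z * x))).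
Proof.
have : is_derive z 1 (c \*: (cos \o ( *%R^~ x))) (c *: (- sin (z * x) * x)).
  apply: is_deriveZ; apply: is_derive1_comp.
  have -> : *%R^~ x = (x \*: id) :> (R -> R) by apply/funext => y; rewrite mulrC.
  by apply: is_derive_eq; rewrite /GRing.scale /= mulr1.
by rewrite /GRing.scale /= mulrA mulrAC mulrN.
Qed.

Lemma is_derive_sinM (c x z : R) :
  is_derive z 1 (fun z : R => c * sin (z * x)) (c * x * cos (z * x)).
Proof.
have : is_derive z 1 (c \*: (sin \o ( *%R^~ x))) (c *: (cos (z * x) * x)).
  apply: is_deriveZ; apply: is_derive1_comp.
  have -> : *%R^~ x = (x \*: id) :> (R -> R) by apply/funext => y; rewrite mulrC.
  by apply: is_derive_eq; rewrite /GRing.scale /= mulr1.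
by rewrite /GRing.scale /= mulrA mulrAC.
Qed.

(** Differentiation under the integral sign, dominated by |X|^(n + 1). The pair
    (h, k) stands for a bounded function and its derivative, which covers both
    the cosine and the sine. *)
Lemma derive_under_moment (h k : R -> R) (n : nat) (z : R) :
  (forall c x y : R, is_derive y 1 (fun z : R => c * h (z * x)) (c * x * k (y * x))) ->
  (forall y, measurable_fun setT (fun x : R => h (y * x))) ->
  (forall x, `|h x| <= 1) -> (forall x, `|k x| <= 1) ->
  is_derive z 1 (fun z : R => \int[P]_w (X w ^+ n * h (z * X w)))
    (\int[P]_w (X w ^+ n.+1 * k (z * X w))).
Proof.
move=> hk mh h1 k1.
pose f z w := X w ^+ n * h (z * X w).
have d1f x w : partial1of2 f x w = X w ^+ n.+1 * k (x * X w).
  by rewrite partial1of2E exprSr; have [_ ->] := hk (X w ^+ n) (X w) x.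
have zI : `]z - 1, z + 1[%classic z.
  by rewrite /= in_itv/= ltrDl gtrBl ltr01.
have intf x : `]z - 1, z + 1[%classic x -> P.-integrable setT (EFin \o f x).
  by move=> _; exact: (integrable_Xn_bounded n (mh x)).
have df x w : `]z - 1, z + 1[%classic x -> setT w -> derivable (f^~ w) x 1.
  by move=> _ _; have [? _] := hk (X w ^+ n) (X w) x.
have G0 w : 0 <= `|X w| ^+ n.+1 by exact: exprn_ge0.
have Gub x w : `]z - 1, z + 1[%classic x -> setT w ->
    `|partial1of2 f x w| <= `|X w| ^+ n.+1.
  by move=> _ _; rewrite d1f normrM normrX ler_piMr ?exprn_ge0.
have iG := all_moments_norm n.+1 hX.
apply: DeriveDef.
  exact: (derivable_under_integral measurableT zI intf df G0 iG Gub).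
rewrite -derive1E (differentiation_under_integral measurableT zI intf df G0 iG Gub).
by apply: eq_Rintegral => w _; rewrite d1f.
Qed.

Lemma is_derive_cos_moment n (z : R) :
  is_derive z 1 (cos_moment n) (- sin_moment n.+1 z).
Proof.
rewrite (_ : - _ = \int[P]_w (X w ^+ n.+1 * (\- sin) (z * X w))); last first.
  rewrite /sin_moment -mulN1r -RintegralZl//.
    by apply: eq_Rintegral => w _; rewrite /= mulN1r mulrN.
  by apply: (integrable_Xn_bounded _ (measurable_sinM z)) => x; rewrite ler_norml sin_geN1 sin_le1.
apply: (derive_under_moment (h := cos) (k := \- sin)).
- by move=> c x y; apply: is_derive_eq (is_derive_cosM _ _ _) _; rewrite /= mulrN.
- exact: measurable_cosM.
- by move=> x; rewrite ler_norml cos_geN1 cos_le1.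
- by move=> x /=; rewrite normrN ler_norml sin_geN1 sin_le1.
Qed.

Lemma is_derive_sin_moment n (z : R) :
  is_derive z 1 (sin_moment n) (cos_moment n.+1 z).
Proof.
apply: (derive_under_moment (h := sin) (k := cos)).
- exact: is_derive_sinM.
- exact: measurable_sinM.
- by move=> x; rewrite ler_norml sin_geN1 sin_le1.
- by move=> x; rewrite ler_norml cos_geN1 cos_le1.
Qed.

Lemma derive1_cos_moment n : (cos_moment n)^`() = fun z => - sin_moment n.+1 z.
Proof.
by apply/funext => z; rewrite derive1E; have [_ ->] := is_derive_cos_moment n z.
Qed.

Lemma derive1_sin_moment n : (sin_moment n)^`() = cos_moment n.+1.
Proof.
by apply/funext => z; rewrite derive1E; have [_ ->] := is_derive_sin_moment n z.
Qed.

Lemma smooth_cos_sin_moment m n z :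
  smooth m (cos_moment n) z /\ smooth m (sin_moment n) z.
Proof.
elim: m n => [|m IH] n //; split; split.
- by apply: filterE => y; have [] := is_derive_cos_moment n y.
- by rewrite derive1_cos_moment; apply: smoothN; exact: (IH n.+1).2.
- by apply: filterE => y; have [] := is_derive_sin_moment n y.
- by rewrite derive1_sin_moment; exact: (IH n.+1).1.
Qed.

(** Differentiation in z multiplies the integrand X^n exp (i z X) by i X. *)
Lemma derive1n_cos_sin_moment j n :
  ((cos_moment n)^`(j) 0 +i* (sin_moment n)^`(j) 0)%C =
  'i%C ^+ j * ((moment X (n + j)%N)%:C)%C.
Proof.
elim: j n => [|j IH] n.
  rewrite expr0 mul1r addn0 /cos_moment /sin_moment /moment.
  congr (_ +i* _)%C; first by apply: eq_Rintegral => w _; rewrite mul0r cos0 mulr1.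
  rewrite [LHS](_ : _ = \int[P]_w (0 : R)); first exact: Rintegral_cst1.
  by apply: eq_Rintegral => w _; rewrite mul0r sin0 mulr0.
rewrite !derive1Sn derive1_cos_moment derive1_sin_moment derive1nN; last first.
  by have [] := smooth_cos_sin_moment j n.+1 0.
rewrite addnS -addSn exprS -mulrA -IH.
by apply/eqP; rewrite eq_complex /= !mul0r !mul1r sub0r add0r !eqxx.
Qed.

Lemma char_funE z : char_fun P X z = (cos_moment 0 z +i* sin_moment 0 z)%C.
Proof.
rewrite /char_fun unlock /cos_moment /sin_moment /Rintegral.
by congr (_ +i* _)%C; congr fine; apply: eq_integral => w _; rewrite expr0 mul1r.
Qed.

(** The derivatives of order n of phi at 0 are i^n mu_n, and those of log phi
    satisfy with them the recursion [are_cumulants]. Multiplying both sequences by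
    (- i)^n preserves the recursion, which determines the cumulants. *)
Lemma cumulantE m : (0 < m)%N ->
  cumulant P m X = ((alg_cumulant (moment X) m)%:C)%C.
Proof.
move=> m0.
have c0 : cos_moment 0 0 = 1.
  rewrite -(moment0 X); apply: eq_Rintegral => w _.
  by rewrite mul0r cos0 mulr1.
have sc n : smooth n (cos_moment 0) 0 by have [] := smooth_cos_sin_moment n 0 0.
have ss n : smooth n (sin_moment 0) 0 by have [] := smooth_cos_sin_moment n 0 0.
have H := are_cumulants_clog c0 sc ss.
pose mu n : R[i] := ((moment X n)%:C)%C.
have mu0 : mu 0%N = 1 by rewrite /mu moment0.
have charE : char_fun P X = fun z => (cos_moment 0 z +i* sin_moment 0 z)%C.
  by apply/funext => z; exact: char_funE.
have cumE n : cumulant P n X = (- 'i%C) ^+ n *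
    cderive1n n (fun z => clog (cos_moment 0 z +i* sin_moment 0 z)%C) 0.
  by rewrite /cumulant charE.
have Hmu : are_cumulants (fun n => cumulant P n X) mu.
  move=> n; have HZ := are_cumulantsZ (- 'i%C) H n.
  have muE j : (- 'i%C) ^+ j * ((cos_moment 0)^`(j) 0 +i* (sin_moment 0)^`(j) 0)%C = mu j.
    rewrite derive1n_cos_sin_moment add0n mulrA -exprMn mulNr -expr2 sqr_i opprK.
    by rewrite expr1n mul1r.
  apply: etrans (esym (muE n.+1)) (etrans HZ _); apply: eq_bconv => j _; last first.
    exact: muE.
  exact: esym (cumE j.+1).
rewrite -(alg_cumulantE mu0 Hmu m0).
apply: (alg_cumulantE mu0 (kap := fun n => ((alg_cumulant (moment X) n)%:C)%C)) => // n.
rewrite /mu alg_cumulantP ?moment0// /bconv rmorph_sum.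
by apply: eq_bigr => j _; rewrite !rmorphM rmorph_nat.
Qed.

End characteristic_function.
End moments.

(** * Independence and mixed moments *)

Section independence_of_variables.
Context (d : measure_display) (T : measurableType d) (R : realType)
        (P : probability T R).
Implicit Types X Y W J : T -> R.

Definition mfun_of d' (T' : measurableType d') (f : T -> T')
  (mf : measurable_fun setT f) : {mfun T >-> T'} :=
  MeasurableFun.Pack (MeasurableFun.Class (isMeasurableFun.Build _ _ _ _ f mf)).

Definition indep_rv X Y := independent2 P (sigma_rv X) (sigma_rv Y).

Lemma indep_rvE X Y : indep_rv X Y <-> forall A B : set R, measurable A ->
  measurable B -> P (X @^-1` A `&` Y @^-1` B) = (P (X @^-1` A) * P (Y @^-1` B))%E.
Proof.
split=> [XY A B mA mB|XY _ _ [A mA <-] [B mB <-]]; last exact: XY.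
by apply: XY; [exists A|exists B].
Qed.

Lemma indep_rv_comp X Y (f g : R -> R) : measurable_fun setT f ->
  measurable_fun setT g -> indep_rv X Y -> indep_rv (f \o X) (g \o Y).
Proof.
move=> mf mg /indep_rvE XY; apply/indep_rvE => A B mA mB.
apply: (XY (f @^-1` A) (g @^-1` B)); rewrite -[X in measurable X]setTI.
  exact: mf.
exact: mg.
Qed.

Lemma integrable_mixed X Y j l : all_moments P X -> all_moments P Y ->
  P.-integrable setT (EFin \o (fun w => X w ^+ j * Y w ^+ l)).
Proof.
move=> hX hY; have [[mX _] [mY _]] := (hX, hY).
apply: (integrable_le (Y := fun w => `|X w| ^+ (j * 2) + `|Y w| ^+ (l * 2))).
- by apply: measurable_funM; exact: measurable_funX.
- by apply: integrable_addr; exact: all_moments_norm.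
- move=> w; rewrite normrM !normrX !exprM.
  set x := `|X w| ^+ j; set y := `|Y w| ^+ l.
  have x0 : 0 <= x by exact: exprn_ge0.
  have y0 : 0 <= y by exact: exprn_ge0.
  nra.
Qed.

(** The joint law is the product of the two laws, so that the expectation is
    given by Fubini's theorem. *)
Lemma indep_mixed_moment X Y j l : all_moments P X -> all_moments P Y ->
  indep_rv X Y ->
  \int[P]_w (X w ^+ j * Y w ^+ l) = moment P X j * moment P Y l.
Proof.
move=> hX hY /indep_rvE XY; have [[mX iX] [mY iY]] := (hX, hY).
pose rX := mfun_of mX; pose rY := mfun_of mY.
pose rXY := mfun_of (measurable_fun_pair mX mY).
pose f (z : R * R) := ((z.1 ^+ j * z.2 ^+ l)%:E : \bar R).
have mf : measurable_fun setT f.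
  apply/measurable_EFinP/measurable_funM; apply: measurable_funX.
    exact: measurable_fst.
  exact: measurable_snd.
have ifXY : P.-integrable setT (f \o rXY) by exact: integrable_mixed.
have joint A : measurable A ->
    (distribution P rX \x distribution P rY)%E A = distribution P rXY A.
  move=> mA; apply: product_measure_unique mA.
  by move=> B C mB mC; exact: XY.
have iprod : (distribution P rX \x distribution P rY)%E.-integrable setT f.
  have /integrableP[_ fy] : (distribution P rXY).-integrable setT f.
    exact: integrable_pushforward.
  apply/integrableP; split => //; apply: le_lt_trans fy; rewrite le_eqVlt.
  by apply/orP; left; apply/eqP/eq_measure_integral => A mA _; exact: joint.
have imX : (distribution P rX).-integrable setT (EFin \o (fun x => x ^+ j)).
  apply: integrable_pushforward => //.
    by apply/measurable_EFinP/measurable_funX.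
  exact: iX.
have imY : (distribution P rY).-integrable setT (EFin \o (fun x => x ^+ l)).
  apply: integrable_pushforward => //.
    by apply/measurable_EFinP/measurable_funX.
  exact: iY.
have momX : (\int[distribution P rX]_x (x ^+ j)%:E = (moment P X j)%:E)%E.
  rewrite (integral_distribution (X := rX))/=; last exact: iX.
    by rewrite /moment /Rintegral fineK// integrable_fin_num//; exact: iX.
  by apply/measurable_EFinP/measurable_funX.
have momY : (\int[distribution P rY]_x (x ^+ l)%:E = (moment P Y l)%:E)%E.
  rewrite (integral_distribution (X := rY))/=; last exact: iY.
    by rewrite /moment /Rintegral fineK// integrable_fin_num//; exact: iY.
  by apply/measurable_EFinP/measurable_funX.
rewrite /Rintegral -[LHS]/(fine (\int[P]_w (f \o rXY) w)).
rewrite -(integral_distribution mf ifXY).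
rewrite (eq_measure_integral (distribution P rX \x distribution P rY)%E); last first.
  by move=> A mA _; exact/esym/joint.
rewrite -integral12_prod_meas1//.
rewrite (eq_integral (fun x : R => (x ^+ j)%:E * (moment P Y l)%:E)%E) => [|x _].
  by rewrite integralZr//= momX.
by rewrite -momY -integralZl//; apply: eq_integral.
Qed.

(** Truncation to the interval from - A to A. It is bounded and 1-Lipschitz, so
    that expectations of powers of truncated variables are continuous for
    convergence in probability. *)
Definition clip (A x : R) := Num.max (- A) (Num.min x A).

Lemma measurable_clip A : measurable_fun setT (clip A).
Proof.
apply: measurable_maxr => //; apply: measurable_minr => //.
Qed.

Lemma clip_le A x : 0 <= A -> `|clip A x| <= A.
Proof.
by move=> A0; rewrite /clip ler_norml le_max lexx /= ge_max ge_min lexx orbT andbT; lra.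
Qed.

Lemma clip_le_norm A x : 0 <= A -> `|clip A x| <= `|x|.
Proof.
move=> A0; rewrite /clip ler_norml le_max ge_max le_min ge_min ler_norm.
by have := normr_ge0 x; have := ler_norm (- x); rewrite normrN; lra.
Qed.

Lemma clip_lipschitz A x y : `|clip A x - clip A y| <= `|x - y|.
Proof.
rewrite ler_norml /clip !minEle !maxEle.
have := ler_norm (x - y); have := ler_norm (y - x); rewrite [`|y - x|]distrC.
move: `|x - y| => e ? ?.
case: (leP x A) => ?; case: (leP y A) => ?;
  case: (leP (- A) x) => ?; case: (leP (- A) y) => ?; case: (leP (- A) A) => ?;
  apply/andP; split; lra.
Qed.

Lemma clip_id A x : `|x| <= A -> clip A x = x.
Proof. by rewrite /clip ler_norml => /andP[? ?]; rewrite min_l// max_r. Qed.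

Lemma exprn_lipschitz A l : 0 <= A -> exists2 K : R, 0 <= K &
  forall a b, `|a| <= A -> `|b| <= A -> `|a ^+ l - b ^+ l| <= K * `|a - b|.
Proof.
move=> A0; elim: l => [|l [K K0 IH]].
  by exists 0 => // a b _ _; rewrite !expr0 subrr normr0 mul0r.
exists (A * K + A ^+ l) => [|a b aA bA]; first by rewrite addr_ge0 ?mulr_ge0 ?exprn_ge0.
have -> : a ^+ l.+1 - b ^+ l.+1 = a * (a ^+ l - b ^+ l) + (a - b) * b ^+ l.
  by rewrite !exprS; ring.
apply: (le_trans (ler_normD _ _)); rewrite [leRHS]mulrDl lerD// normrM.
  by rewrite -mulrA ler_pM ?IH.
by rewrite mulrC ler_wpM2r// normrX lerXn2r ?nnegrE.
Qed.

(** [J] is a limit in probability of variables independent of [X]. This form of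
    independence can be read off from the definition of a stochastic integral as
    a limit of Riemann sums, and it is enough to factor mixed moments. *)
Definition indep_approximable X (J : T -> R) := forall eps eta : R, 0 < eps -> 0 < eta ->
  exists W, [/\ measurable_fun setT W, indep_rv X W &
    (P [set w | (eps < `|W w - J w|)%R] <= eta%:E)%E].

Lemma all_moments_bounded X (A : R) : measurable_fun setT X ->
  (forall w, `|X w| <= A) -> all_moments P X.
Proof.
move=> mX XA; split => // m; apply: (integrable_le (Y := fun=> A ^+ m)).
- exact: measurable_funX.
- exact: integrable_cst.
- by move=> w; rewrite normrX; apply: lerXn2r; rewrite ?nnegrE// (le_trans _ (XA w)).
Qed.

Lemma all_moments_clip A X : 0 <= A -> measurable_fun setT X ->
  all_moments P (clip A \o X).
Proof.
move=> A0 mX; apply: (@all_moments_bounded _ A).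
  exact: measurableT_comp (measurable_clip _) mX.
by move=> w; exact: clip_le.
Qed.

Lemma normr_Rintegral_le X Y : P.-integrable setT (EFin \o X) ->
  P.-integrable setT (EFin \o Y) -> (forall w, `|X w| <= Y w) ->
  `|\int[P]_w X w| <= \int[P]_w Y w.
Proof.
move=> iX iY XY; apply: (le_trans (le_normr_Rintegral measurableT iX)).
by apply: le_Rintegral => //; exact: integrable_norm.
Qed.

Lemma integrable_subr X Y : P.-integrable setT (EFin \o X) ->
  P.-integrable setT (EFin \o Y) ->
  P.-integrable setT (EFin \o (fun w => X w - Y w)).
Proof.
move=> iX iY; rewrite (_ : EFin \o _ = (EFin \o X) \- (EFin \o Y))%E//.
exact: integrableB.
Qed.

(** The formula holds for the independent approximations [W] of [J]. Replacing [W]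
    by [J] changes both sides by O(e) if P (|W - J| > e) <= e: outside of this
    event the truncated powers differ by O(e) by the Lipschitz property, and on it
    they are bounded. *)
Lemma clip_mixed_moment A X J j l : 0 < A -> measurable_fun setT X ->
  measurable_fun setT J -> indep_approximable X J ->
  \int[P]_w (clip A (X w) ^+ j * clip A (J w) ^+ l) =
  moment P (clip A \o X) j * moment P (clip A \o J) l.
Proof.
move=> A0 mX mJ XJ; have A0' := ltW A0.
have hX := all_moments_clip A0' mX; have hJ := all_moments_clip A0' mJ.
have [K K0 HK] := exprn_lipschitz l A0'.
pose B := A ^+ j; have B0 : 0 <= B by exact: exprn_ge0.
have main e : 0 < e ->
  `|\int[P]_w (clip A (X w) ^+ j * clip A (J w) ^+ l) -
  moment P (clip A \o X) j * moment P (clip A \o J) l| <=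
    (B + B) * (K * (e + (A + A) * e)).
  move=> e0; have [W [mW XW We]] := XJ e e e0 e0.
  have hW := all_moments_clip A0' mW.
  pose D w := `|clip A (W w) ^+ l - clip A (J w) ^+ l|.
  pose E := [set w | e < `|W w - J w|].
  have mE : measurable E.
    rewrite /E -[X in measurable X]setTI.
    by apply: measurable_fun_ltr => //; apply: measurableT_comp => //; exact: measurable_funB.
  have iD : P.-integrable setT (EFin \o D).
    by apply: integrable_norm; apply: integrable_subr; [exact: hW.2|exact: hJ.2].
  have DE w : D w <= K * (e + (A + A) * \1_E w).
    apply: le_trans (HK _ _ (clip_le _ A0') (clip_le _ A0')) _.
    rewrite ler_wpM2l// indicE; case: (boolP (w \in E)) => [_|].
      rewrite mulr1 (le_trans (ler_normB _ _))// ler_wpDl ?(ltW e0)//.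
      by rewrite lerD// clip_le.
    rewrite mulr0 addr0 notin_setE /E /= => /negP; rewrite -leNgt => h.
    exact: le_trans (clip_lipschitz _ _ _) h.
  have intD : \int[P]_w D w <= K * (e + (A + A) * e).
    apply: (@le_trans _ _ (\int[P]_w (K * (e + (A + A) * \1_E w)))).
      apply: le_Rintegral => //.
      apply/integrable_mulr/integrable_addr; first exact: integrable_cst.
      by apply/integrable_mulr/integrable_indic.
    rewrite RintegralZl//; last first.
      apply: integrable_addr; first exact: integrable_cst.
      by apply/integrable_mulr/integrable_indic.
    rewrite ler_wpM2l// RintegralD//; last 2 first.
    - exact: integrable_cst.
    - by apply/integrable_mulr/integrable_indic.
    rewrite Rintegral_cst1 lerD2l RintegralZl//; last exact: integrable_indic.
    rewrite ler_wpM2l ?addr_ge0// /Rintegral integral_indic// setIT.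
    by rewrite -lee_fin fineK// fin_num_measure.
  have iXW := integrable_mixed j l hX hW; have iXJ := integrable_mixed j l hX hJ.
  have E1 : `|\int[P]_w (clip A (X w) ^+ j * clip A (W w) ^+ l) -
      \int[P]_w (clip A (X w) ^+ j * clip A (J w) ^+ l)| <= B * \int[P]_w D w.
    rewrite -RintegralB// -RintegralZl//.
    apply: normr_Rintegral_le.
    - exact: integrable_subr.
    - exact: integrable_mulr.
    - move=> w; rewrite -mulrBr normrM ler_wpM2r// normrX.
      by apply: lerXn2r; rewrite ?nnegrE// clip_le.
  have E2 : `|moment P (clip A \o X) j| <= B.
    rewrite -(Rintegral_cst1 P B); apply: normr_Rintegral_le.
    - exact: hX.2.
    - exact: integrable_cst.
    - by move=> w; rewrite normrX; apply: lerXn2r; rewrite ?nnegrE// clip_le.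
  have E3 : `|moment P (clip A \o W) l - moment P (clip A \o J) l| <= \int[P]_w D w.
    rewrite /moment -RintegralB//; [|exact: hW.2|exact: hJ.2].
    by apply: le_normr_Rintegral => //; apply: integrable_subr; [exact: hW.2|exact: hJ.2].
  have XWE : \int[P]_w (clip A (X w) ^+ j * clip A (W w) ^+ l) =
      moment P (clip A \o X) j * moment P (clip A \o W) l.
    apply: indep_mixed_moment => //.
    exact: indep_rv_comp (measurable_clip _) (measurable_clip _) XW.
  rewrite XWE in E1.
  move: E1 E2 E3.
  set u := \int[P]_w (clip A (X w) ^+ j * _); set a := moment _ _ _.
  set b := moment _ _ _; set c := moment _ _ _ => E1 E2 E3.
  have -> : u - a * c = a * (b - c) - (a * b - u) by ring.
  apply: le_trans (ler_normB _ _) _; rewrite normrM mulrDl lerD//.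
    by rewrite ler_pM// (le_trans E3).
  by apply: le_trans E1 _; rewrite ler_wpM2l.
apply/eqP; rewrite -subr_eq0 -normr_eq0; apply/eqP/le_anti.
rewrite normr_ge0 andbT; apply/ler_addgt0Pl => e e0; rewrite addr0.
(* [main] bounds the difference by (L - 1) e; with e / L it is at most e. *)
pose L := (B + B) * (K * (1 + (A + A))) + 1.
have L0 : 0 < L by rewrite ltr_wpDl// !mulr_ge0 ?addr_ge0.
apply: le_trans (main (e / L) _) _; first by rewrite divr_gt0.
have -> : (B + B) * (K * (e / L + (A + A) * (e / L))) = (L - 1) / L * e.
  by rewrite /L; ring.
rewrite ler_piMl ?(ltW e0)// ler_pdivrMr// mul1r gerBl//.
Qed.

Lemma Rintegral_dominated_cvg (F : nat -> T -> R) (f g : T -> R) :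
  (forall n, measurable_fun setT (F n)) -> measurable_fun setT f ->
  {ae P, forall w, F n w @[n --> \oo] --> f w} ->
  P.-integrable setT (EFin \o g) -> (forall n w, `|F n w| <= g w) ->
  P.-integrable setT (EFin \o f) /\
  \int[P]_w F n w @[n --> \oo] --> \int[P]_w f w.
Proof.
move=> mF mf Ff ig Fg.
have [] := @dominated_convergence _ _ _ P setT measurableT
  (fun n => EFin \o F n) (EFin \o f) (EFin \o g).
- by move=> n; exact/measurable_EFinP.
- exact/measurable_EFinP.
- move: Ff; apply: filterS => w Fw _.
  by apply: cvg_EFin => //; exact: nearW.
- exact: ig.
- by apply: aeW => w n _ /=; rewrite lee_fin.
move=> intf _ cv; split => //.
apply: fine_cvg; rewrite fineK; first exact: cv.
exact: integrable_fin_num.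
Qed.

Lemma cvg_exprn (u : nat -> R) (x : R) m :
  u n @[n --> \oo] --> x -> u n ^+ m @[n --> \oo] --> x ^+ m.
Proof.
move=> ux; elim: m => [|m IH]; first exact: cvg_cst.
rewrite exprS; under eq_fun do rewrite exprS.
exact: cvgM.
Qed.

Lemma clip_cvg x : clip n.+1%:R x @[n --> \oo] --> x.
Proof.
apply: cvg_near_cst; exists (Num.bound `|x|) => // n /= bn; apply: clip_id.
apply: (le_trans (ltW (archi_boundP _))) => //.
by rewrite ler_nat (leq_trans bn).
Qed.

Lemma clip_moment_cvg X j : all_moments P X ->
  moment P (clip n.+1%:R \o X) j @[n --> \oo] --> moment P X j.
Proof.
move=> hX; have [mX iX] := hX.
have [] // := @Rintegral_dominated_cvg (fun n w => clip n.+1%:R (X w) ^+ j)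
  (fun w => X w ^+ j) (fun w => `|X w| ^+ j).
- by move=> n; apply: measurable_funX; exact: measurableT_comp (measurable_clip _) mX.
- exact: measurable_funX.
- by apply: aeW => w; apply: cvg_exprn; exact: clip_cvg.
- exact: all_moments_norm.
- by move=> n w; rewrite normrX; apply: lerXn2r; rewrite ?nnegrE// clip_le_norm.
Qed.

(** Truncate both variables at n + 1 and let n tend to infinity; |X^j J^l|
    dominates. *)
Lemma approx_mixed_moment X J j l : all_moments P X -> all_moments P J ->
  indep_approximable X J ->
  \int[P]_w (X w ^+ j * J w ^+ l) = moment P X j * moment P J l.
Proof.
move=> hX hJ XJ; have [[mX iX] [mJ iJ]] := (hX, hJ).
have [_ cv] : P.-integrable setT (EFin \o (fun w => X w ^+ j * J w ^+ l)) /\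
    \int[P]_w (clip n.+1%:R (X w) ^+ j * clip n.+1%:R (J w) ^+ l) @[n --> \oo] -->
    \int[P]_w (X w ^+ j * J w ^+ l).
  apply: (@Rintegral_dominated_cvg (fun n w => clip n.+1%:R (X w) ^+ j * clip n.+1%:R (J w) ^+ l)
    _ (fun w => `|X w ^+ j * J w ^+ l|)).
  - move=> n; apply: measurable_funM; apply: measurable_funX.
      exact: measurableT_comp (measurable_clip _) mX.
    exact: measurableT_comp (measurable_clip _) mJ.
  - by apply: measurable_funM; exact: measurable_funX.
  - by apply: aeW => w; apply: cvgM; apply: cvg_exprn; exact: clip_cvg.
  - by apply: integrable_norm; exact: integrable_mixed.
  - move=> n w; rewrite !normrM !normrX; apply: ler_pM; rewrite ?exprn_ge0//;
      by apply: lerXn2r; rewrite ?nnegrE// clip_le_norm.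
have cv' := cvgM (@clip_moment_cvg X j hX) (@clip_moment_cvg J l hJ).
apply: (cvg_unique _ cv) => //.
rewrite (_ : (fun n => _) = fun n => moment P (clip n.+1%:R \o X) j * moment P (clip n.+1%:R \o J) l).
  exact: cv'.
by apply/funext => n; exact: clip_mixed_moment.
Qed.

Lemma Rintegral_sum (I : Type) (s : seq I) (F : I -> T -> R) :
  (forall i, P.-integrable setT (EFin \o F i)) ->
  P.-integrable setT (EFin \o (fun w => \sum_(i <- s) F i w)) /\
  \int[P]_w (\sum_(i <- s) F i w) = \sum_(i <- s) \int[P]_w F i w.
Proof.
move=> iF; elim: s => [|i s [IH1 IH2]].
  under eq_fun do rewrite big_nil.
  by rewrite Rintegral_cst1 big_nil; split => //; exact: integrable_cst.
under eq_fun do rewrite big_cons.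
rewrite big_cons -IH2 RintegralD//; split => //; exact: integrable_addr.
Qed.

Lemma moment_addE X Y n : all_moments P X -> all_moments P Y ->
  (forall j l, \int[P]_w (X w ^+ j * Y w ^+ l) = moment P X j * moment P Y l) ->
  moment P (fun w => X w + Y w) n = bconv (moment P X) (moment P Y) n.
Proof.
move=> hX hY XY; rewrite /moment /bconv.
under eq_Rintegral do rewrite addrC exprDn.
have ib (j : 'I_n.+1) : P.-integrable setT
    (EFin \o (fun w => 'C(n, j)%:R * (X w ^+ j * Y w ^+ (n - j)))).
  by apply: integrable_mulr; exact: integrable_mixed.
transitivity (\sum_(j < n.+1) \int[P]_w ('C(n, j)%:R * (X w ^+ j * Y w ^+ (n - j)))).
  rewrite -(Rintegral_sum _ ib).2; apply: eq_Rintegral => w _; apply: eq_bigr => j _.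
  by rewrite -mulr_natl [Y w ^+ _ * _]mulrC.
apply: eq_bigr => j _; rewrite RintegralZl//; last exact: integrable_mixed.
by rewrite XY mulrA.
Qed.

Lemma cumulantD_indep X Y m : all_moments P X -> all_moments P Y ->
  indep_approximable X Y -> (0 < m)%N ->
  alg_cumulant (moment P (fun w => X w + Y w)) m =
  alg_cumulant (moment P X) m + alg_cumulant (moment P Y) m.
Proof.
move=> hX hY XY m0; rewrite -alg_cumulantD ?moment0//.
apply: eq_alg_cumulant => // [|j _]; first exact: moment0.
by apply: moment_addE => // ? ?; exact: approx_mixed_moment.
Qed.

Lemma indep_rv_approximable X J : measurable_fun setT J -> indep_rv X J ->
  indep_approximable X J.
Proof.
move=> mJ XJ eps eta eps0 eta0; exists J; split => //.
rewrite (_ : [set w | _] = set0) ?measure0 ?lee_fin ?(ltW eta0)//.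
by apply/seteqP; split=> w //=; rewrite subrr normr0 ltNge (ltW eps0).
Qed.

(** Uniqueness of finite measures on a pi-system, applied to A |-> P (A `&` B)
    and A |-> P A * P B, which have the same total mass. *)
Lemma independent_generated (G : set (set T)) (B : set T) :
  G `<=` measurable -> setI_closed G -> G setT -> measurable B ->
  (forall A, G A -> P (A `&` B) = (P A * P B)%E) ->
  forall A, <<s G >> A -> P (A `&` B) = (P A * P B)%E.
Proof.
move=> Gm GI GT mB GB A GA.
have PB0 : 0 <= fine (P B) by rewrite fine_ge0.
pose c := NngNum PB0.
have cE : (c%:num)%:E = P B by rewrite /= fineK// fin_num_measure.
have mscaleE A' : mscale c P A' = (P A' * P B)%E by rewrite /mscale /= fineK ?fin_num_measure// muleC.
rewrite -mscaleE -[LHS]/(mrestr P mB A).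
apply: (g_sigma_algebra_measure_unique G Gm (fun=> setT)) => //.
- by rewrite bigcup_const.
- by move=> A' GA'; apply: etrans (GB A' GA') _; rewrite -mscaleE.
- move=> _; change (P (setT `&` B) < +oo)%E.
  by rewrite setTI -ge0_fin_numE// fin_num_measure.
Qed.

(** The pi-system of the intersections of one event from each of the first [N]
    sigma-algebras, which generates their join. *)
Definition cylinders (H : nat -> set (set T)) N : set (set T) :=
  [set A | exists2 B : nat -> set T, (forall k, <<s H k >> (B k)) &
     A = \bigcap_(k in [set` iota 0 N]) B k].

Section cylinders.
Variables (H : nat -> set (set T)) (N : nat).
Hypothesis Hm : forall k, <<s H k >> `<=` measurable.

Lemma sub_sigmaT (G : set (set T)) : <<s G >> setT.
Proof. exact: (@measurableT _ (g_sigma_algebraType G)). Qed.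

Lemma cylinders_setI : setI_closed (cylinders H N).
Proof.
move=> _ _ [A HA ->] [B HB ->]; exists (fun k => A k `&` B k); last by rewrite bigcapI.
move=> k; apply: (@measurableI _ (g_sigma_algebraType (H k)) (A k) (B k)).
  exact: HA.
exact: HB.
Qed.

Lemma cylinders_measurable : cylinders H N `<=` measurable.
Proof.
move=> _ [A HA ->]; apply: fin_bigcap_measurable; first exact: finite_seq.
by move=> k _; apply: Hm; exact: HA.
Qed.

Lemma cylindersT : cylinders H N setT.
Proof.
exists (fun=> setT); last by rewrite bigcapT.
by move=> k; exact: sub_sigmaT.
Qed.

Lemma sub_cylinders k A : (k < N)%N -> <<s H k >> A -> cylinders H N A.
Proof.
move=> kN HA; exists (fun j => if j == k then A else setT).
  by move=> j; case: eqP => [->//|_]; exact: sub_sigmaT.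
apply/seteqP; split=> [w Aw j /= _|w /(_ k)]; first by case: eqP.
by rewrite /= eqxx; apply; rewrite mem_iota.
Qed.

(** The hypothesis on the family, for the indices 0, ..., N. *)
Lemma cylinders_indep : independent_systems P (fun k => <<s H k >>) ->
  forall A B, cylinders H N A -> <<s H N >> B -> P (A `&` B) = (P A * P B)%E.
Proof.
move=> indH _ B [A HA ->] HB.
pose A' k := if k == N then B else A k.
have HA' k : <<s H k >> (A' k) by rewrite /A'; case: eqP => [->|].
have AA' : \bigcap_(k in [set` iota 0 N]) A k = \bigcap_(k in [set` iota 0 N]) A' k.
  apply: eq_bigcapr => k /=; rewrite mem_iota /= add0n => kN.
  by rewrite /A' (ltn_eqF kN).
have BN : A' N = B by rewrite /A' eqxx.
have S : [set` N :: iota 0 N] = N |` [set` iota 0 N].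
  apply/seteqP; split=> k /=; rewrite in_cons; first by move/predU1P.
  by move=> [->|->]; rewrite ?eqxx ?orbT.
rewrite AA' -[in LHS]BN setIC -bigcap_setU1 -S.
rewrite !indH ?iota_uniq//; first by rewrite big_cons BN muleC.
by rewrite /= mem_iota /= add0n ltnn iota_uniq.
Qed.

End cylinders.

(** The sum is measurable for the join of the first [N] sigma-algebras, which is
    independent of the next one because the pi-system [cylinders] is. *)
Lemma independent_sum (H : nat -> set (set T)) (V : nat -> T -> R) N :
  (forall k, <<s H k >> `<=` measurable) ->
  independent_systems P (fun k => <<s H k >>) ->
  (forall k, sigma_rv (V k) `<=` <<s H k >>) ->
  indep_rv (fun w => \sum_(0 <= k < N) V k w) (V N).
Proof.
move=> Hm indH VH _ B [A mA <-] sB.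
have HB : <<s H N >> B by exact: VH.
apply: (@independent_generated (cylinders H N)).
- exact: cylinders_measurable.
- exact: cylinders_setI.
- exact: cylindersT.
- exact: Hm HB.
- by move=> C GC; exact: (cylinders_indep indH GC HB).
(* Terms of index at least [N] are replaced by 0 to have a family of which
   every member is measurable for [cylinders H N]. *)
have mV k : measurable_fun setT ((fun w => if (k < N)%N then V k w else 0) :
    g_sigma_algebraType (cylinders H N) -> R).
  have [kN|_] := boolP (k < N)%N; last exact: measurable_cst.
  move=> _ C mC; rewrite setTI; apply: sub_sigma_algebra.
  by apply: (sub_cylinders kN); apply: VH; exists C.
have -> : (fun w => \sum_(0 <= k < N) V k w) =
    (fun w => \sum_(0 <= k < N) (if (k < N)%N then V k w else 0)).
  apply/funext => w; rewrite big_nat [RHS]big_nat.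
  by apply: eq_bigr => k /andP[_ ->].
have := measurable_sum (index_iota 0 N) mV measurableT mA.
by rewrite setTI.
Qed.

End independence_of_variables.

(** * Sums of powers weighted by the parameters of the superposition *)

Section weighted_sums.
Variable R : realType.
Implicit Types (x rho : R).

(** The mean value theorem for x^(m+1), by induction on [m]. *)
Lemma exprS_diff_le x m : 1 <= x ->
  x ^+ m.+1 - (x - 1) ^+ m.+1 <= m.+1%:R * x ^+ m.
Proof.
move=> x1; elim: m => [|m IH]; first by rewrite !expr1 expr0 opprB addrC subrK mulr1.
have -> : x ^+ m.+2 - (x - 1) ^+ m.+2 =
    x * (x ^+ m.+1 - (x - 1) ^+ m.+1) + (x - 1) ^+ m.+1 by rewrite !exprS; ring.
rewrite -[m.+2]addn1 natrD mulrDl mul1r lerD//.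
  by rewrite [in leRHS]exprS [leRHS]mulrCA ler_wpM2l// (le_trans ler01).
by apply: lerXn2r; rewrite ?nnegrE ?subr_ge0 ?(le_trans ler01)// gerBl.
Qed.

Lemma exprS_diff_ge x m : 1 <= x -> x ^+ m <= x ^+ m.+1 - (x - 1) ^+ m.+1.
Proof.
move=> x1.
have h : (x - 1) ^+ m <= x ^+ m.
  by apply: lerXn2r; rewrite ?nnegrE ?subr_ge0 ?(le_trans ler01)// gerBl.
have := ler_wpM2l (_ : 0 <= x - 1) h; rewrite subr_ge0 => /(_ x1).
by rewrite -exprS => h'; rewrite lerBrDr -lerBrDl (le_trans h')// exprS; lra.
Qed.

Lemma natr_exp_sum_ge n m :
  n%:R ^+ m.+1 <= m.+1%:R * \sum_(j < n) (j.+1%:R : R) ^+ m.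
Proof.
elim: n => [|n IH]; first by rewrite expr0n big_ord0 mulr0.
rewrite big_ord_recr /= mulrDr.
have := @exprS_diff_le n.+1%:R m (_ : 1 <= _); rewrite ler1n => /(_ isT).
by rewrite -(natr1 n) addrK; lra.
Qed.

Definition geom rho j : R := \sum_(i < j) rho ^+ i.

Lemma geomS rho j : geom rho j.+1 = 1 + rho * geom rho j.
Proof.
rewrite /geom big_ord_recl expr0 mulr_sumr; congr (_ + _).
by apply: eq_bigr => i _; rewrite /= -exprS.
Qed.

Section geom_bounds.
Variable rho : R.
Hypotheses (rho0 : 0 < rho) (rho1 : rho < 1).

Lemma geom_ge0 j : 0 <= geom rho j.
Proof. by apply: sumr_ge0 => i _; rewrite exprn_ge0// ltW. Qed.

Lemma geomS_ge1 j : 1 <= geom rho j.+1.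
Proof. by rewrite geomS lerDl mulr_ge0 ?geom_ge0// ltW. Qed.

Lemma geom_le_natr j : geom rho j <= j%:R.
Proof.
rewrite -[X in X%:R](card_ord j) -sum1_card natr_sum; apply: ler_sum => i _.
by apply: exprn_ile1; rewrite ltW.
Qed.

Lemma geom_le_inv j : geom rho j <= (1 - rho)^-1.
Proof.
have d0 : 0 < 1 - rho by rewrite subr_gt0.
rewrite -[leRHS]mul1r ler_pdivlMr//.
elim: j => [|j IH]; first by rewrite /geom big_ord0 mul0r ler01.
rewrite geomS mulrDl mul1r -mulrA; have := ler_wpM2l (ltW rho0) IH; lra.
Qed.

Lemma geom_ge j : j%:R * rho ^+ j <= geom rho j.
Proof.
rewrite -[X in X%:R](card_ord j) -sum1_card natr_sum mulr_suml.
apply: ler_sum => i _; rewrite mul1r; apply: ler_wiXn2l; [exact: ltW..|exact/ltnW/ltn_ord].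
Qed.

End geom_bounds.

(** The ratio of the cumulants of order [m] of X(1) + ... + X(n) and of X(0), for
    a stationary process of Ornstein-Uhlenbeck type that decays by the factor
    [rho] in unit time ([OU_partial_sum_cumulant]). *)
Definition OU_weight m rho n : R :=
  \sum_(j < n) (geom rho j.+1 ^+ m - (geom rho j.+1 - 1) ^+ m).

Section OU_weight_bounds.
Variables (rho : R) (m : nat).
Hypotheses (rho0 : 0 < rho) (rho1 : rho < 1).

Lemma OU_weight_ge0 n : 0 <= OU_weight m.+1 rho n.
Proof.
apply: sumr_ge0 => j _; apply: le_trans (exprS_diff_ge _ _) => //.
  by rewrite exprn_ge0// geom_ge0.
exact: geomS_ge1.
Qed.

Lemma OU_weight_le_of (b : R) n : (forall j, (j < n)%N -> geom rho j.+1 <= b) ->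
  OU_weight m.+1 rho n <= n%:R * (m.+1%:R * b ^+ m).
Proof.
move=> gb; rewrite -[X in X%:R](card_ord n) -sum1_card natr_sum mulr_suml.
apply: ler_sum => j _; rewrite mul1r.
apply: le_trans (exprS_diff_le _ (geomS_ge1 rho0 _)) _.
by rewrite ler_wpM2l// lerXn2r ?nnegrE ?geom_ge0 ?gb// (le_trans _ (gb j _))// geom_ge0.
Qed.

Lemma OU_weight_le_natr n : OU_weight m.+1 rho n <= m.+1%:R * n%:R ^+ m.+1.
Proof.
apply: le_trans (OU_weight_le_of (b := n%:R) _) _ => [j jn|].
  by apply: (le_trans (geom_le_natr _ _ _)); rewrite // ler_nat.
by rewrite mulrCA -exprS.
Qed.

(** As long as rho^n >= c, geom j is at least c j; the sum of j^m over j <= n is of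
    order n^(m+1). *)
Lemma OU_weight_ge c n : 0 <= c -> c <= rho ^+ n ->
  c ^+ m * n%:R ^+ m.+1 / m.+1%:R <= OU_weight m.+1 rho n.
Proof.
move=> c0 cr; rewrite ler_pdivrMr// mulrC.
apply: (@le_trans _ _ (c ^+ m * (m.+1%:R * \sum_(j < n) j.+1%:R ^+ m))).
  by rewrite mulrC ler_wpM2l ?exprn_ge0// natr_exp_sum_ge.
rewrite mulrCA mulrC ler_wpM2r// mulr_sumr; apply: ler_sum => j _.
apply: le_trans (exprS_diff_ge _ (geomS_ge1 rho0 _)).
rewrite -exprMn; apply: lerXn2r; rewrite ?nnegrE ?geom_ge0 ?mulr_ge0//.
apply: le_trans (geom_ge _ _ _) => //; rewrite mulrC ler_wpM2l//.
by apply: (le_trans cr); rewrite ler_wiXn2l ?ltW.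
Qed.

End OU_weight_bounds.

Section power_weights.
Variables (lambda alpha : R).
Hypotheses (lambda0 : 0 < lambda) (alpha0 : 0 < alpha) (alpha1 : alpha < 1).

Local Notation rho k := (expR (- (lambda / k.+1%:R))).
Local Notation delta k := (k.+1%:R `^ (- (1 + alpha))).
Local Notation rate n := (n%:R `^ (- alpha)).

Lemma decay_gt0 k : 0 < rho k. Proof. exact: expR_gt0. Qed.

Lemma decay_lt1 k : rho k < 1.
Proof. by rewrite -expR0 ltr_expR oppr_lt0 divr_gt0. Qed.

Lemma deltaE k : delta k = rate k.+1 / k.+1%:R.
Proof.
by rewrite opprD addrC powRD ?(gt_eqF (ltr0Sn R k)) ?implybT// powR_inv1.
Qed.

#[local] Hint Resolve decay_gt0 decay_lt1 ltr0Sn powR_ge0 : core.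

Lemma powR_natrS k (b : R) : (0 < k)%N ->
  k%:R `^ b = k.+1%:R `^ b * expR (b * ln (1 - k.+1%:R^-1)).
Proof.
move=> k0; have k0' : 0 < k%:R :> R by rewrite ltr0n.
rewrite /powR !gt_eqF// -expRD -mulrDr -lnM ?posrE//; last first.
  by rewrite subr_gt0 invf_lt1// ltr1n.
by rewrite mulrBr mulr1 divff ?gt_eqF// -natr1 addrK.
Qed.

Lemma ln_1subV_le k : (0 < k)%N -> ln (1 - k.+1%:R^-1 : R) <= - k.+1%:R^-1.
Proof.
move=> k0; apply: le_ln1Dx; rewrite ltrN2.
by rewrite invf_lt1// ltr1n.
Qed.

(** The sum is compared with the integral of x^(- 1 - alpha): the differences of
    the primitive - x^(- alpha) / alpha telescope. *)
Lemma powR_tail_term_le k : (0 < k)%N -> delta k <= alpha^-1 * (rate k - rate k.+1).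
Proof.
move=> k0; rewrite deltaE mulrC ler_pdivlMl//.
rewrite [rate k]powR_natrS//.
suff : 1 + alpha * k.+1%:R^-1 <= expR (- alpha * ln (1 - k.+1%:R^-1)).
  move=> /(ler_wpM2l (powR_ge0 k.+1%:R (- alpha))).
  rewrite mulrDr mulr1 => h; rewrite lerBrDl (le_trans _ h)//.
  by rewrite lerD2l mulrA [leRHS]mulrC.
apply: (le_trans (expR_ge1Dx _)).
by rewrite ler_expR mulNr -mulrN ler_pM2l// lerNr ln_1subV_le.
Qed.

Lemma powR_tail_sum_le n N : (0 < n)%N ->
  \sum_(n <= k < n + N) delta k <= alpha^-1 * rate n.
Proof.
move=> n0; apply: (@le_trans _ _ (alpha^-1 * (rate n - rate (n + N)%N))); last first.
  by rewrite ler_pM2l ?invr_gt0// gerBl.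
elim: N => [|N IH]; first by rewrite addn0 big_geq// subrr mulr0.
rewrite addnS big_nat_recr ?leq_addr//=.
by have := powR_tail_term_le (ltn_addr N n0); lra.
Qed.

Lemma natr_powR_rate n : (0 < n)%N -> n%:R * rate n = n%:R `^ (1 - alpha).
Proof.
move=> n0; rewrite powRD; last by rewrite pnatr_eq0 (gtn_eqF n0) implybT.
by rewrite powRr1.
Qed.

(** The same for x^(- alpha), whose primitive is x^(1 - alpha) / (1 - alpha). The
    factor 2 gives room for the discretization. *)
Lemma powR_head_term_le k :
  rate k.+1 <= 2 / (1 - alpha) * (k.+1%:R * rate k.+1 - k%:R * rate k).
Proof.
have b0 : 0 < 1 - alpha by rewrite subr_gt0.
rewrite mulrAC ler_pdivlMr//.
case: k => [|k].
  rewrite mul0r subr0 mul1r mulrC ler_wpM2r//.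
  by have := alpha0; lra.
rewrite [_.+1%:R * rate _.+1]natr_powR_rate// [k.+1%:R * _ in leRHS]natr_powR_rate//.
rewrite (powR_natrS (k := k.+1))// -natr_powR_rate//.
set y := (1 - alpha) / k.+2%:R.
have y0 : 0 < y by rewrite divr_gt0.
have y1 : y <= 1.
  by rewrite ler_pdivrMr// mul1r (@le_trans _ _ 1)// ?ler1n// gerBl ltW.
have e1 : expR ((1 - alpha) * ln (1 - k.+2%:R^-1)) <= (1 + y)^-1.
  apply: (@le_trans _ _ (expR (- y))).
    by rewrite ler_expR /y -mulrN ler_pM2l// ln_1subV_le.
  by rewrite expRN lef_pV2 ?posrE ?expR_gt0 ?expR_ge1Dx ?addr_gt0.
have e2 : (1 + y)^-1 <= 1 - y / 2.
  by rewrite -[leLHS]mul1r ler_pdivrMr ?addr_gt0//; nra.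
have -> : rate k.+2 * (1 - alpha) = k.+2%:R * rate k.+2 * y.
  by rewrite /y; field; rewrite gt_eqF.
have v0 : 0 <= k.+2%:R * rate k.+2 by rewrite mulr_ge0.
have := ler_wpM2l v0 (le_trans e1 e2).
lra.
Qed.

Lemma powR_head_sum_le n : \sum_(0 <= k < n) rate k.+1 <= 2 / (1 - alpha) * (n%:R * rate n).
Proof.
elim: n => [|n IH]; first by rewrite big_geq// mul0r mulr0.
rewrite big_nat_recr//=; apply: le_trans (lerD IH (powR_head_term_le n)) _.
by rewrite -mulrDr [X in _ * X <= _]addrC subrK.
Qed.

(** For k >= n the weight is at most m n^m. For k < n, the geometric sums are
    bounded by 1 / (1 - rho_k) = O(k), so that the weight is O(n k^(m-1)); as
    m >= 2, delta_k n k^(m-1) = n k^(m-2) k^(- alpha) <= n^(m-1) k^(- alpha), and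
    the sum of k^(- alpha) over k < n is of order n^(1 - alpha). *)
Lemma OU_weight_sum_le m : exists2 A : R, 0 <= A & forall n N, (0 < n)%N ->
  \sum_(0 <= k < N) delta k * OU_weight m.+2 (rho k) n <= A * (n%:R ^+ m.+2 * rate n).
Proof.
(* [D] is such that 1 / (1 - rho k) <= D (k + 1). *)
pose D := 1 + lambda^-1.
have D0 : 0 <= D by rewrite addr_ge0// invr_ge0 ltW.
pose A1 : R := m.+2%:R * D ^+ m.+1 * (2 / (1 - alpha)).
pose A2 : R := m.+2%:R * alpha^-1.
exists (A1 + A2) => [|n N n0].
  by rewrite addr_ge0// !mulr_ge0 ?exprn_ge0 ?invr_ge0 ?subr_ge0 ?(ltW alpha1) ?(ltW alpha0).
have n0' : 0 < n%:R :> R by rewrite ltr0n.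
have T0 k : 0 <= delta k * OU_weight m.+2 (rho k) n by rewrite mulr_ge0// OU_weight_ge0.
apply: (@le_trans _ _ (\sum_(0 <= k < n + N) delta k * OU_weight m.+2 (rho k) n)).
  by rewrite addnC [leRHS](@big_cat_nat _ _ _ N 0%N)/= ?leq_addr// lerDl sumr_ge0.
rewrite (@big_cat_nat _ _ _ n 0%N)/= ?leq_addr// mulrDl lerD//.
  have head k : (k < n)%N -> delta k * OU_weight m.+2 (rho k) n <=
      m.+2%:R * D ^+ m.+1 * n%:R ^+ m.+1 * rate k.+1.
    move=> kn.
    have g j : geom (rho k) j.+1 <= D * k.+1%:R.
      apply: (le_trans (geom_le_inv _ _ _)) => //.
      have rinv : rho k <= (1 + lambda / k.+1%:R)^-1.
        rewrite expRN lef_pV2 ?posrE ?expR_gt0 ?expR_ge1Dx//.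
        by rewrite addr_gt0// divr_gt0.
      have y0 : 0 < lambda / k.+1%:R by rewrite divr_gt0.
      have y1 : 0 < 1 + lambda / k.+1%:R by rewrite addr_gt0.
      rewrite -[leLHS]mul1r ler_pdivrMr ?subr_gt0//.
      apply: (@le_trans _ _ (D * k.+1%:R * (1 - (1 + lambda / k.+1%:R)^-1))).
        have -> : 1 - (1 + lambda / k.+1%:R)^-1 = lambda / (k.+1%:R + lambda).
          by field; rewrite [1 + _]addrC natr1 !gt_eqF// addr_gt0.
        rewrite [leRHS]mulrA ler_pdivlMr ?addr_gt0// mul1r /D mulrAC mulrDl mul1r mulVf ?gt_eqF//.
        rewrite mulrDl mul1r addrC lerD2r.
        by rewrite ler_pMr// ler1n.
      by rewrite ler_wpM2l ?mulr_ge0// lerD2l lerN2.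
    have -> : m.+2%:R * D ^+ m.+1 * n%:R ^+ m.+1 * rate k.+1 =
      n%:R ^+ m * (rate k.+1 * (n%:R * (m.+2%:R * D ^+ m.+1))) by rewrite [n%:R ^+ m.+1]exprS; ring.
    have Gle := OU_weight_le_of m.+1 (decay_gt0 k) (fun j (_ : (j < n)%N) => g j).
    apply: le_trans (ler_wpM2l (powR_ge0 k.+1%:R (- (1 + alpha))) Gle) _.
    rewrite deltaE exprMn.
    have -> : rate k.+1 / k.+1%:R * (n%:R * (m.+2%:R * (D ^+ m.+1 * k.+1%:R ^+ m.+1))) =
      k.+1%:R ^+ m * (rate k.+1 * (n%:R * (m.+2%:R * D ^+ m.+1))).
      by rewrite [k.+1%:R ^+ m.+1]exprS; field; rewrite gt_eqF.
    apply: ler_wpM2r; first by rewrite !mulr_ge0// exprn_ge0.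
    by apply: lerXn2r; rewrite ?nnegrE// ler_nat.
  apply: (@le_trans _ _ (\sum_(0 <= k < n) m.+2%:R * D ^+ m.+1 * n%:R ^+ m.+1 * rate k.+1)).
    by rewrite big_nat [leRHS]big_nat; apply: ler_sum => k /andP[_ kn]; exact: head.
  rewrite -mulr_sumr (le_trans (ler_wpM2l _ (powR_head_sum_le n)))//.
    by rewrite !mulr_ge0// exprn_ge0.
  by rewrite le_eqVlt; apply/orP; left; apply/eqP; rewrite /A1 [n%:R ^+ m.+2]exprS; ring.
apply: (@le_trans _ _ (\sum_(n <= k < n + N) delta k * (m.+2%:R * n%:R ^+ m.+2))).
  by apply: ler_sum => k _; rewrite ler_wpM2l// OU_weight_le_natr.
rewrite -mulr_suml (le_trans (ler_wpM2r _ (powR_tail_sum_le N n0)))//.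
by rewrite le_eqVlt; apply/orP; left; apply/eqP; rewrite /A2; ring.
Qed.

(** The indices n <= k < 2n are enough: there rho_k^n >= exp (- lambda), so that
    each weight is of order n^m, and each delta_k is of order n^(- 1 - alpha). *)
Lemma OU_weight_sum_ge m : exists2 c : R, 0 < c & forall n N, (0 < n)%N ->
  (n + n <= N)%N ->
  c * (n%:R ^+ m.+1 * rate n) <= \sum_(0 <= k < N) delta k * OU_weight m.+1 (rho k) n.
Proof.
pose c0 : R := expR (- lambda) ^+ m / m.+1%:R.
have c00 : 0 < c0 by rewrite divr_gt0// exprn_gt0// expR_gt0.
exists (c0 / 4) => [|n N n0 nN]; first by rewrite divr_gt0.
have n0' : 0 < n%:R :> R by rewrite ltr0n.
have T0 k : 0 <= delta k * OU_weight m.+1 (rho k) n by rewrite mulr_ge0// OU_weight_ge0.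
rewrite (@big_cat_nat _ _ _ (n + n)%N 0%N)//= (@big_cat_nat _ _ _ n 0%N (n + n)%N)/= ?leq_addr//.
apply: (@le_trans _ _ (\sum_(n <= k < n + n) delta k * OU_weight m.+1 (rho k) n)); last first.
  by rewrite addrAC lerDr addr_ge0// sumr_ge0.
have term k : (n <= k < n + n)%N ->
    rate n / 4 / n%:R * (c0 * n%:R ^+ m.+1) <= delta k * OU_weight m.+1 (rho k) n.
  move=> /andP[nk kn]; apply: ler_pM.
  - by rewrite !divr_ge0.
  - by rewrite mulr_ge0 ?(ltW c00)// exprn_ge0.
  - have k2n : k.+1%:R <= 2 * n%:R :> R.
      by rewrite -natrM ler_nat mulSn mul1n.
    rewrite deltaE [leLHS](_ : _ = rate n / 2 * (2 * n%:R)^-1); last first.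
      by field; rewrite gt_eqF.
    apply: ler_pM; rewrite ?divr_ge0 ?invr_ge0 ?mulr_ge0//; last first.
      by rewrite lef_pV2 ?posrE// mulr_gt0.
    rewrite !powRN -invfM lef_pV2 ?posrE ?mulr_gt0 ?powR_gt0//.
    apply: (@le_trans _ _ ((2 * n%:R) `^ alpha)).
      by rewrite ge0_ler_powR ?nnegrE ?(ltW alpha0) ?mulr_ge0.
    rewrite powRM// mulrC ler_pM2l ?powR_gt0//.
    by rewrite -[leRHS]powRr1// ler_powR ?ler1n// ltW.
  - have := @OU_weight_ge (rho k) m (decay_gt0 k) (decay_lt1 k) (expR (- lambda)) n (expR_ge0 _).
    rewrite /c0 mulrAC; apply.
    rewrite -expRM_natl ler_expR mulrN lerN2 mulrCA ger_pMr//.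
    by rewrite ler_pdivrMr// mul1r ler_nat (leq_trans nk).
apply: (@le_trans _ _ (\sum_(n <= k < n + n) rate n / 4 / n%:R * (c0 * n%:R ^+ m.+1))).
  rewrite sumr_const_nat addnK -[leRHS]mulr_natr le_eqVlt; apply/orP; left; apply/eqP.
  by field; rewrite gt_eqF.
by rewrite big_nat [leRHS]big_nat; apply: ler_sum => k; exact: term.
Qed.

End power_weights.
End weighted_sums.

(** * Partial sums of one stationary Ornstein-Uhlenbeck type process *)

Section stationarity.
Context (d : measure_display) (T : measurableType d) (R : realType)
        (P : probability T R).
Variable Y : R -> {RV P >-> R}.
Hypothesis stY : stationary P Y.

(** The product sigma-algebra on vectors is presented by the sets on which
    stationarity is tested; they form a pi-system. *)
Definition rectangles n : set (set ('I_n -> R)) :=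
  [set [set x | forall i, B i (x i)] | B in
    [set B : 'I_n -> set R | forall i, measurable (B i)]].

Lemma rectangles_setI n : setI_closed (@rectangles n).
Proof.
move=> _ _ [A mA <-] [B mB <-]; exists (fun i => A i `&` B i).
  by move=> i; exact: measurableI.
by apply/seteqP; split=> x /= => [H|[H1 H2] i]; [split=> i; case: (H i)|split].
Qed.

Lemma rectanglesT n : @rectangles n setT.
Proof. by exists (fun=> setT) => //; apply/seteqP; split. Qed.

Lemma measurable_coord n (i : 'I_n) :
  measurable_fun setT (fun x : g_sigma_algebraType (@rectangles n) => x i).
Proof.
move=> _ B mB; rewrite setTI; apply: sub_sigma_algebra.
exists (fun j => if j == i then B else setT) => [j|]; first by case: eqP.
apply/seteqP; split=> x /= => [/(_ i)|Bi j]; first by rewrite eqxx.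
by case: eqP => // ->.
Qed.

Lemma measurable_vector n (X : 'I_n -> T -> R) :
  (forall i, measurable_fun setT (X i)) ->
  measurable_fun setT (fun w => (X ^~ w) : g_sigma_algebraType (@rectangles n)).
Proof.
move=> mX; apply: (@measurability _ _ T (g_sigma_algebraType (@rectangles n)) setT _
  (@rectangles n)) => //.
move=> _ [_ [B mB <-] <-]; rewrite setTI.
rewrite (_ : _ @^-1` _ = \bigcap_(i in [set: 'I_n]) (X i @^-1` B i)); last first.
  by apply/seteqP; split=> w /= => [H i _|H i]; [exact: H|exact: (H i I)].
apply: fin_bigcap_measurable; first exact: finite_finset.
by move=> i _; rewrite -[X in measurable X]setTI; exact: mX.
Qed.

(** The laws of the vector and of the shifted vector agree on rectangles, hence
    on the sigma-algebra that they generate. *)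
Lemma stationary_integral n (t : 'I_n -> R) h (f : ('I_n -> R) -> \bar R) :
  (forall i, 0 <= t i) -> 0 <= h ->
  measurable_fun setT (f : g_sigma_algebraType (@rectangles n) -> \bar R) ->
  P.-integrable setT (fun w => f (fun i => Y (t i) w)) ->
  P.-integrable setT (fun w => f (fun i => Y (t i + h) w)) ->
  (\int[P]_w f (fun i => Y (t i + h)%R w) = \int[P]_w f (fun i => Y (t i) w))%E.
Proof.
move=> t0 h0 mf if1 if2.
have m1 := measurable_vector (fun i => @measurable_funPT _ _ _ _ (Y (t i))).
have m2 := measurable_vector (fun i => @measurable_funPT _ _ _ _ (Y (t i + h))).
rewrite -[LHS](@integral_distribution _ _ _ _ _ P (mfun_of m2) f mf if2).
rewrite -[RHS](@integral_distribution _ _ _ _ _ P (mfun_of m1) f mf if1).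
apply: eq_measure_integral => A mA _.
apply: (@measure_unique _ R (g_sigma_algebraType (@rectangles n)) (@rectangles n) (fun=> setT)) => //.
- exact: rectangles_setI.
- by move=> _; exact: rectanglesT.
- by rewrite bigcup_const.
- by move=> _ [B mB <-]; exact: stY.
- by move=> _; rewrite -ge0_fin_numE// fin_num_measure.
Qed.

Lemma stationary_same_law t (B : set R) : 0 <= t -> measurable B ->
  P (Y t @^-1` B) = P (Y 0 @^-1` B).
Proof.
move=> t0 mB.
have := @stY 1 (fun=> 0) t (fun=> B) (fun=> lexx 0) t0 (fun=> mB).
have E s : [set w | 'I_1 -> B (Y s w)] = Y s @^-1` B.
  by apply/seteqP; split=> w /= H; [exact: H ord0|move=> _; exact: H].
by rewrite /= !E add0r.
Qed.

Lemma stationary_all_moments t : 0 <= t ->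
  (forall p, (2 <= p)%N -> ('E_P[fun w => (`|Y 0 w| ^+ p)%R] < +oo)%E) ->
  all_moments P (Y t).
Proof.
move=> t0 Y0; apply: all_moments_abs => // p p2.
apply: le_lt_trans (Y0 p p2); rewrite le_eqVlt; apply/orP; left; apply/eqP.
rewrite unlock.
have mf : measurable_fun setT (fun x : R => (`|x| ^+ p)%:E).
  by apply/measurable_EFinP; apply: measurable_funX; exact: normr_measurable.
have f0 (x : R) : (0 <= (`|x| ^+ p)%:E)%E by rewrite lee_fin exprn_ge0.
rewrite -[LHS](ge0_integral_distribution (Y t) mf f0).
rewrite -[RHS](ge0_integral_distribution (Y 0) mf f0).
by apply: eq_measure_integral => A mA _; exact: stationary_same_law.
Qed.

Hypothesis momY : forall t, 0 <= t -> all_moments P (Y t).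

(** Shift by one unit of time the sum of the coordinates. *)
Lemma stationary_moment_sum n m :
  moment P (fun w => \sum_(i < n) Y i.+1%:R w) m =
  moment P (fun w => \sum_(i < n) Y i%:R w) m.
Proof.
pose f (x : 'I_n -> R) := (((\sum_(i < n) x i) ^+ m)%:E : \bar R).
have mf : measurable_fun setT (f : g_sigma_algebraType (@rectangles n) -> \bar R).
  apply/measurable_EFinP/measurable_funX/measurable_sum => i.
  exact: measurable_coord.
have i1 (s : 'I_n -> R) : (forall i, 0 <= s i) ->
    P.-integrable setT (fun w => f (fun i => Y (s i) w)).
  move=> s0; have [_] := all_moments_sum (index_enum 'I_n) (fun i => momY (s0 i)).
  exact.
rewrite /moment /Rintegral; congr fine.
have := @stationary_integral n (fun i => i%:R) 1 f (fun i => ler0n _ _) ler01 mf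
  (i1 _ _) (i1 _ _).
rewrite /f => <- //=; apply: eq_integral => w _; congr ((_ ^+ _)%:E).
by apply: eq_bigr => i _; rewrite natr1.
Qed.

End stationarity.

Section approximation.
Context (d : measure_display) (T : measurableType d) (R : realType)
        (P : probability T R).
Implicit Types (J W X : T -> R) (G : set (set T)).

Definition gen_measurable G W :=
  measurable_fun setT (W : g_sigma_algebraType G -> R).

(** [J] is a limit in probability of variables measurable for the sigma-algebra
    generated by [G]. *)
Definition gen_approximable G J := forall eps eta : R, 0 < eps -> 0 < eta ->
  exists2 W, gen_measurable G W &
    (P [set w | (eps < `|W w - J w|)%R] <= eta%:E)%E.

Lemma gen_measurableW G W : <<s G >> `<=` measurable -> gen_measurable G W ->
  measurable_fun setT W.
Proof.
move=> Gm mW _ B mB; apply: Gm.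
exact: (mW measurableT B mB).
Qed.

Lemma measurable_gtr_norm X e : measurable_fun setT X ->
  measurable [set w | e < `|X w|].
Proof.
move=> mX; rewrite -[X in measurable X]setTI.
by apply: measurable_fun_ltr => //; exact: measurableT_comp.
Qed.

(** The solution formula identifies the noise with a stochastic integral almost
    surely only. *)
Lemma gen_approximable_ae G J J' : <<s G >> `<=` measurable ->
  measurable_fun setT J -> measurable_fun setT J' ->
  {ae P, forall w, J w = J' w} -> gen_approximable G J -> gen_approximable G J'.
Proof.
move=> Gm mJ mJ' JJ' GJ eps eta eps0 eta0.
have [W GW We] := GJ eps eta eps0 eta0; exists W => //.
have mW := gen_measurableW Gm GW.
have [N [mN N0 JN]] := JJ'; apply: le_trans We.
have m1 := measurable_gtr_norm eps (measurable_funB mW mJ).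
have m2 := measurable_gtr_norm eps (measurable_funB mW mJ').
apply: (@le_trans _ _ (P ([set w | (eps < `|W w - J w|)%R] `|` N))).
  apply: le_measure; rewrite ?inE//; first exact: measurableU.
  move=> w /= h; have [JJ|nJ] := eqVneq (J w) (J' w); first by left; rewrite /= JJ.
  by right; apply: JN => /= /eqP; exact/negP.
apply: (@le_trans _ _ (P [set w | (eps < `|W w - J w|)%R] + P N)%E).
  exact: (measureU2 _ m1 mN).
by rewrite N0 adde0.
Qed.

Lemma gen_approximableD G J J' : <<s G >> `<=` measurable ->
  measurable_fun setT J -> measurable_fun setT J' ->
  gen_approximable G J -> gen_approximable G J' ->
  gen_approximable G (fun w => J w + J' w).
Proof.
move=> Gm mJ mJ' GJ GJ' eps eta eps0 eta0.
have e2 : 0 < eps / 2 by rewrite divr_gt0.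
have t2 : 0 < eta / 2 by rewrite divr_gt0.
have [W GW We] := GJ _ _ e2 t2; have [W' GW' We'] := GJ' _ _ e2 t2.
exists (fun w => W w + W' w); first exact: measurable_funD.
have mW := gen_measurableW Gm GW; have mW' := gen_measurableW Gm GW'.
have m1 := measurable_gtr_norm (eps / 2) (measurable_funB mW mJ).
have m2 := measurable_gtr_norm (eps / 2) (measurable_funB mW' mJ').
apply: (@le_trans _ _ (P ([set w | (eps / 2 < `|W w - J w|)%R] `|`
   [set w | (eps / 2 < `|W' w - J' w|)%R]))).
  apply: le_measure; rewrite ?inE.
  - apply: (measurable_gtr_norm eps (X := fun w => W w + W' w - (J w + J' w))).
    by apply: measurable_funB; exact: measurable_funD.
  - exact: measurableU.
  - move=> w /= H.
    have := ler_normD (W w - J w) (W' w - J' w).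
    rewrite (_ : W w - J w + (W' w - J' w) = W w + W' w - (J w + J' w)); last by ring.
    move=> H'; have [|h1] := ltP (eps / 2) `|W w - J w|; first by left.
    by right; rewrite /=; lra.
apply: (le_trans (measureU2 _ m1 m2)).
by rewrite (splitr eta) EFinD; exact: leeD.
Qed.

Lemma gen_approximable_cst0 G : gen_approximable G (fun=> 0).
Proof.
move=> eps eta eps0 eta0; exists (fun=> 0); first exact: measurable_cst.
rewrite (_ : [set w | _] = set0) ?measure0 ?lee_fin ?(ltW eta0)//.
by apply/seteqP; split=> w //=; rewrite subrr normr0 ltNge (ltW eps0).
Qed.

Lemma gen_approximable_sum G (J : nat -> T -> R) n : <<s G >> `<=` measurable ->
  (forall i, measurable_fun setT (J i)) -> (forall i, gen_approximable G (J i)) ->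
  gen_approximable G (fun w => \sum_(i < n) J i w).
Proof.
move=> Gm mJ GJ; elim: n => [|n IH].
  by under eq_fun do rewrite big_ord0; exact: gen_approximable_cst0.
under eq_fun do rewrite big_ord_recr /=.
by apply: gen_approximableD => //; exact: measurable_sum.
Qed.

Lemma gen_indep_approximable G X J : <<s G >> `<=` measurable ->
  independent2 P (sigma_rv X) <<s G >> -> gen_approximable G J ->
  indep_approximable P X J.
Proof.
move=> Gm XG GJ eps eta eps0 eta0; have [W GW We] := GJ _ _ eps0 eta0.
exists W; split => //; first exact: gen_measurableW GW.
move=> A _ XA [B mB <-]; apply: XG => //.
by have := GW measurableT B mB; rewrite setTI.
Qed.

End approximation.

Section OU_process.
Context (d : measure_display) (T : measurableType d) (R : realType)
        (P : probability T R).
Variables (lambda : R) (Z X : R -> {RV P >-> R}).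
Hypothesis lambda0 : 0 < lambda.
Hypothesis OU : stationary_OU lambda Z X.
Hypothesis momX : forall t, 0 <= t -> all_moments P (X t).

Let rho := expR (- lambda).
Let GZ := \bigcup_(t in [set t : R | 0 <= t]) sigma_rv (Z t).

Lemma sigma_process_measurable (Y : R -> {RV P >-> R}) :
  sigma_process Y `<=` measurable.
Proof.
apply: smallest_sub; first exact: sigma_algebra_measurable.
by move=> _ [t _ [B mB <-]]; rewrite -[X in measurable X]setTI; exact: measurable_funPT.
Qed.

Lemma uniform_tagged_partition (t mesh : R) : 0 <= t -> 0 < mesh ->
  exists n (s : nat -> R), tagged_partition 0 t mesh n s s /\ forall i, 0 <= s i.
Proof.
move=> t0 mesh0; pose N := (Num.bound (t / mesh)).+1.
have N0 : 0 < N%:R :> R by rewrite ltr0n.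
have tN : t / mesh < N%:R.
  apply: (lt_trans (archi_boundP _)); first by rewrite divr_ge0// ltW.
  by rewrite ltr_nat.
exists N, (fun i => i%:R * (t / N%:R)); split; last first.
  by move=> i; rewrite mulr_ge0// divr_ge0// ltW.
split; first by rewrite mul0r.
  by rewrite mulrCA divff ?mulr1// gt_eqF.
move=> i _; split => //.
  by rewrite ler_wpM2r ?divr_ge0 ?(ltW N0)// ler_nat.
rewrite -mulrBl -natrB// subSnn mul1r ltr_pdivrMr// mulrC.
by rewrite -ltr_pdivrMr.
Qed.

(** A Riemann sum of small mesh is a function of finitely many values of [Z]. *)
Lemma stochastic_integral_approximable (f : R -> R) t (J : T -> R) : 0 <= t ->
  is_stochastic_integral P f 0 t (fun s => Z (lambda * s)) J ->
  gen_approximable P GZ J.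
Proof.
move=> t0 HJ eps eta eps0 eta0; have [mesh mesh0 Hm] := HJ _ _ eps0 eta0.
have [n [s [Hs s0]]] := uniform_tagged_partition t0 mesh0.
exists (fun w => \sum_(0 <= i < n) f (s i) * (Z (lambda * s i.+1) w - Z (lambda * s i) w)).
  have mZ i : gen_measurable GZ (Z (lambda * s i)).
    move=> _ B mB; rewrite setTI; apply: sub_sigma_algebra.
    by exists (lambda * s i); [rewrite /= mulr_ge0// ltW|exists B].
  apply: measurable_sum => i; apply: measurable_funM; first exact: measurable_cst.
  by apply: measurable_funB; exact: mZ.
exact: Hm Hs.
Qed.

(** The part of the partial sum that is produced after time 0: by the solution
    formula, X i - rho^i X 0 is the stochastic integral from 0 to i. *)
Let Y n w := \sum_(i < n) (X i.+1%:R w - rho ^+ i.+1 * X 0 w).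

Lemma OU_noise_indep n : indep_approximable P (X 0) (Y n).
Proof.
apply: gen_indep_approximable (OU_indep_start OU) _; first exact: sigma_process_measurable.
apply: (gen_approximable_sum (J := fun i w => X i.+1%:R w - rho ^+ i.+1 * X 0 w)).
- exact: sigma_process_measurable.
- by move=> i; apply: measurable_funB => //; exact: measurable_funM.
move=> i; have [J HJ XJ] := OU_solution OU (ler0n R i.+1).
apply: (@gen_approximable_ae _ _ _ _ _ J).
- exact: sigma_process_measurable.
- by [].
- by apply: measurable_funB => //; exact: measurable_funM.
- move: XJ; apply: filterS => w ->.
  by rewrite /rho -expRM_natl [i.+1%:R * _]mulrC addrAC subrr add0r.
- exact: stochastic_integral_approximable HJ.
Qed.

Let S n w := \sum_(i < n) X i.+1%:R w.

Lemma all_moments_noise n : all_moments P (Y n).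
Proof.
apply: all_moments_sum => i.
under eq_fun do rewrite -mulNr; apply: all_momentsD; first exact: momX.
by apply: all_momentsZ; exact: momX.
Qed.

Lemma indep_approximableZ c V J : measurable_fun setT V ->
  indep_approximable P V J -> indep_approximable P (fun w => c * V w) J.
Proof.
move=> mV VJ eps eta eps0 eta0; have [W [mW VW We]] := VJ _ _ eps0 eta0.
exists W; split => //.
by apply: (indep_rv_comp (f := *%R c) (g := id)) VW => //; exact: mulrl_measurable.
Qed.

Lemma cumulant_combination c n m : (0 < m)%N ->
  alg_cumulant (moment P (fun w => c * X 0 w + Y n w)) m =
  c ^+ m * alg_cumulant (moment P (X 0)) m + alg_cumulant (moment P (Y n)) m.
Proof.
move=> m0; have hX := momX (lexx 0); have hY := all_moments_noise n.
rewrite (cumulantD_indep (X := fun w => c * X 0 w))//.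
- rewrite -alg_cumulantZ ?moment0//; congr (_ + _).
  apply: eq_alg_cumulant => //; first exact: moment0.
  by move=> j _; exact: moment_scale.
- exact: all_momentsZ.
- by apply: indep_approximableZ; [exact: hX.1|exact: OU_noise_indep].
Qed.

(** Let a = rho + ... + rho^n = geom rho n.+1 - 1. Then S n = a X(0) + Y n, while
    S n.+1 has by stationarity the moments of
    X(0) + ... + X(n) = (1 + a) X(0) + Y n. The cumulant of Y n cancels in the
    difference, which is kappa_m(X(0)) ((1 + a)^m - a^m). *)
Lemma OU_partial_sum_cumulant n m :
  alg_cumulant (moment P (S n)) m.+2 =
  alg_cumulant (moment P (X 0)) m.+2 * OU_weight m.+2 rho n.
Proof.
elim: n => [|n IH].
  rewrite /OU_weight big_ord0 mulr0.
  rewrite -[RHS](alg_cumulant_exp (0 : R) (m := m.+2))//.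
  apply: eq_alg_cumulant => //; first exact: moment0.
  move=> j _; rewrite -(moment_cst P 0 j); congr (moment P _ j).
  by apply/funext => w; rewrite /S big_ord0.
have SE w : S n w = (geom rho n.+1 - 1) * X 0 w + Y n w.
  have -> : geom rho n.+1 - 1 = \sum_(i < n) rho ^+ i.+1.
    rewrite geomS addrC addKr /geom mulr_sumr.
    by apply: eq_bigr => i _; rewrite exprS.
  by rewrite /S /Y sumrB mulr_suml addrC subrK.
have S1E w : \sum_(i < n.+1) X i%:R w = geom rho n.+1 * X 0 w + Y n w.
  by rewrite big_ord_recl -/(S n w) SE; ring.
have -> : alg_cumulant (moment P (S n.+1)) m.+2 =
    alg_cumulant (moment P (fun w => geom rho n.+1 * X 0 w + Y n w)) m.+2.
  apply: eq_alg_cumulant => //; first exact: moment0.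
  move=> j _; rewrite /S (stationary_moment_sum (OU_stationary OU) momX).
  by congr (moment P _ j); apply/funext => w; exact: S1E.
rewrite /OU_weight big_ord_recr /= mulrDr -IH.
have -> : S n = fun w => (geom rho n.+1 - 1) * X 0 w + Y n w.
  by apply/funext => w; exact: SE.
by rewrite !cumulant_combination//; ring.
Qed.

End OU_process.

(** * From cumulants to moments, and limits of moments *)

Section moments_from_cumulants.
Variable R : realType.

(** The size x^j e of the cumulants is multiplicative in x^j, but every further
    factor costs an e. In the recursion for mu_j, all terms other than
    kap_j mu_0 multiply a cumulant by a moment of positive order and are therefore
    of size x^j e^2. The constant [B] depends on the constants [A] alone, which
    gives estimates uniform in x and e. *)
Lemma moments_le_of_cumulants (A : nat -> R) m : (forall j, 0 <= A j) ->
  exists2 B : R, 0 <= B & forall (x e : R) (kap mu : nat -> R),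
  0 <= x -> 0 <= e -> e <= 1 -> mu 0%N = 1 -> are_cumulants kap mu ->
  (forall j, (0 < j <= m)%N -> `|kap j| <= A j * (x ^+ j * e)) ->
  forall j, (0 < j <= m)%N ->
  `|mu j| <= B * (x ^+ j * e) /\ `|mu j - kap j| <= B * (x ^+ j * e ^+ 2).
Proof.
move=> A0; elim: m => [|m [B B0 IH]].
  by exists 0 => // x e kap mu _ _ _ _ _ _ [].
pose K := \sum_(j < m) 'C(m, j)%:R * A j.+1 * B.
have K0 : 0 <= K by apply: sumr_ge0 => j _; rewrite !mulr_ge0.
exists (B + K + A m.+1) => [|x e kap mu x0 e0 e1 mu0 H kapA]; first by rewrite !addr_ge0.
have xe k : 0 <= x ^+ k * e by rewrite mulr_ge0 ?exprn_ge0.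
have xe2 k : 0 <= x ^+ k * e ^+ 2 by rewrite mulr_ge0 ?exprn_ge0.
have e2 k : x ^+ k * e ^+ 2 <= x ^+ k * e.
  by rewrite ler_wpM2l ?exprn_ge0// expr2 ler_piMr.
have kapA' j : (0 < j <= m)%N -> `|kap j| <= A j * (x ^+ j * e).
  by case/andP => j0 jm; apply: kapA; rewrite j0 (leq_trans jm).
have {}IH := IH x e kap mu x0 e0 e1 mu0 H kapA'.
have diff : `|mu m.+1 - kap m.+1| <= K * (x ^+ m.+1 * e ^+ 2).
  rewrite H /bconv big_ord_recr /= binn subnn mu0 mul1r mulr1 /shift addrK.
  apply: (le_trans (ler_norm_sum _ _ _)); rewrite mulr_suml; apply: ler_sum => j _.
  have jm := ltn_ord j.
  have mj : (0 < m - j <= m)%N by rewrite subn_gt0 jm leq_subr.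
  have [muB _] := IH _ mj.
  have kA : `|kap j.+1| <= A j.+1 * (x ^+ j.+1 * e) 
    by apply: kapA; apply/andP; split => //; rewrite ltnS ltnW.
  rewrite !normrM ger0_norm//.
  have -> : 'C(m, j)%:R * A j.+1 * B * (x ^+ m.+1 * e ^+ 2) =
    'C(m, j)%:R * (A j.+1 * (x ^+ j.+1 * e)) * (B * (x ^+ (m - j) * e)).
    have -> : x ^+ m.+1 = x ^+ j.+1 * x ^+ (m - j).
      by rewrite -exprD addSn subnKC// ltnW.
    by ring.
  by apply: ler_pM => //; rewrite ?mulr_ge0// ler_wpM2l.
move=> j /andP[j0]; rewrite leq_eqVlt => /predU1P[->|]; last first.
  rewrite ltnS => jm; have jm' : (0 < j <= m)%N by rewrite j0.
  have [muB dB] := IH j jm'.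
  split; [apply: (le_trans muB)|apply: (le_trans dB)]; rewrite ler_wpM2r//;
    by rewrite -addrA lerDl addr_ge0.
have kA := kapA m.+1 (leqnn _).
split; last first.
  by apply: (le_trans diff); rewrite ler_wpM2r// addrAC lerDr addr_ge0.
rewrite -[mu _](subrK (kap m.+1)); apply: (le_trans (ler_normD _ _)).
rewrite [leRHS]mulrDl lerD//; apply: (le_trans diff).
apply: (@le_trans _ _ (K * (x ^+ m.+1 * e))); first by rewrite ler_wpM2l.
by rewrite ler_wpM2r// lerDr.
Qed.

End moments_from_cumulants.

Section moment_limit.
Context (d : measure_display) (T : measurableType d) (R : realType)
        (P : probability T R).
Variables (F : nat -> T -> R) (f : T -> R) (K : nat -> R).
Hypothesis momF : forall N, all_moments P (F N).
Hypothesis mf : measurable_fun setT f.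
Hypothesis Ff : {ae P, forall w, F N w @[N --> \oo] --> f w}.
Hypothesis FK : forall N j, moment P (F N) (j * 2) <= K j.

(** Fatou's lemma. *)
Lemma limit_even_moment j : (\int[P]_w (f w ^+ (j * 2))%:E <= (K j)%:E)%E.
Proof.
have mF N : measurable_fun setT (fun w => (F N w ^+ (j * 2))%:E).
  by apply/measurable_EFinP/measurable_funX; exact: (momF N).1.
have F0 N w : (0 <= (F N w ^+ (j * 2))%:E)%E.
  by rewrite lee_fin exprM sqr_ge0.
apply: (@le_trans _ _ (\int[P]_w limn_einf (fun N => (F N w ^+ (j * 2))%:E))%E).
  rewrite le_eqVlt; apply/orP; left; apply/eqP; apply: ae_eq_integral => //.
  - by apply/measurable_EFinP/measurable_funX.
  - rewrite (_ : (fun _ => _) = fun w =>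
        (- limn_esup (-%E \o (fun N => (F N w ^+ (j * 2))%:E)))%E).
      apply: measurableT_comp => //; apply: measurable_fun_limn_esup => N.
      exact: measurableT_comp.
    by apply/funext => w; rewrite limn_esupN oppeK.
  - move: Ff; apply: filterS => w Fw _.
    have /cvg_limn_einf_sup[-> _] // :
        (F N w ^+ (j * 2))%:E @[N --> \oo] --> (f w ^+ (j * 2))%:E.
    by apply: cvg_EFin; [exact: nearW|exact: cvg_exprn].
apply: (le_trans (fatou P measurableT mF (fun N w _ => F0 N w))).
rewrite limn_einf_lim; apply: lime_le; first exact: is_cvg_einfs.
apply: nearW => N; apply: (@le_trans _ _ (\int[P]_w (F N w ^+ (j * 2))%:E)%E).
  by apply: ereal_inf_lbound; exists N => /=.
have := FK N j; rewrite -lee_fin /moment /Rintegral fineK//.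
by apply: integrable_fin_num => //; exact: (momF N).2.
Qed.

Lemma limit_all_moments : all_moments P f.
Proof.
apply: all_moments_abs => // p p2; rewrite unlock.
have H : P.-integrable setT (EFin \o (fun w => f w ^+ (p * 2))).
  apply/integrableP; split; first exact/measurable_EFinP/measurable_funX.
  under eq_integral => w _ do rewrite /= ger0_norm ?exprM ?sqr_ge0// -exprM.
  by apply: le_lt_trans (limit_even_moment p) _; rewrite ltry.
have : P.-integrable setT (EFin \o (fun w => `|f w| ^+ p)).
  apply: (integrable_le (Y := fun w => 1 + f w ^+ (p * 2))).
  - by apply: measurable_funX; exact: measurableT_comp.
  - by apply: integrable_addr => //; exact: integrable_cst.
  - move=> w; rewrite normrX normr_id exprM -[f w ^+ p ^+ 2]real_normK ?num_real// normrX.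
    set y := _ ^+ p; have : 0 <= (y - 1) ^+ 2 := sqr_ge0 _.
    have : 0 <= y by exact: exprn_ge0.
    nra.
move=> /integrableP[_]; apply: le_lt_trans.
rewrite le_eqVlt; apply/orP; left; apply/eqP; apply: eq_integral => w _ /=.
by rewrite normrX normr_id.
Qed.

(** The differences h N = F N ^ m - f ^ m tend to 0 almost everywhere and are
    bounded in square mean. From |h| <= |clip A h| + h^2 / A, the first term tends
    to 0 by bounded convergence and the second is uniformly small for large A. *)
Lemma moment_cvg m : moment P (F N) m @[N --> \oo] --> moment P f m.
Proof.
have momf := limit_all_moments.
pose h N w := F N w ^+ m - f w ^+ m.
have ih N : P.-integrable setT (EFin \o h N).
  by apply: integrable_subr; [exact: (momF N).2|exact: momf.2].
have mh N : measurable_fun setT (h N).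
  by apply: measurable_funB; apply: measurable_funX => //; exact: (momF N).1.
pose L := (K m + K m) + (K m + K m).
have momfK : moment P f (m * 2) <= K m.
  have := limit_even_moment m; rewrite -lee_fin /moment /Rintegral fineK//.
  by apply: integrable_fin_num => //; exact: momf.2.
have K0 : 0 <= K m.
  by apply: le_trans momfK; apply: Rintegral_ge0 => w _; rewrite exprM sqr_ge0.
have L0 : 0 <= L by rewrite !addr_ge0.
have ih2 N : P.-integrable setT (EFin \o (fun w => h N w ^+ 2)) /\
    \int[P]_w (h N w ^+ 2) <= L.
  have iY : P.-integrable setT (EFin \o (fun w => 2 * F N w ^+ (m * 2) + 2 * f w ^+ (m * 2))).
    by apply: integrable_addr; apply: integrable_mulr; [exact: (momF N).2|exact: momf.2].
  have le2 w : h N w ^+ 2 <= 2 * F N w ^+ (m * 2) + 2 * f w ^+ (m * 2).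
    rewrite /h !exprM; set a := F N w ^+ m; set b := f w ^+ m.
    have : 0 <= (a + b) ^+ 2 := sqr_ge0 _.
    by rewrite !expr2; lra.
  have ih2 : P.-integrable setT (EFin \o (fun w => h N w ^+ 2)).
    apply: integrable_le iY _; first exact: measurable_funX.
    by move=> w; rewrite ger0_norm ?sqr_ge0.
  split => //; apply: le_trans (le_Rintegral measurableT ih2 iY (fun w _ => le2 w)) _.
  rewrite RintegralD//; last 2 first.
  - by apply: integrable_mulr; exact: (momF N).2.
  - by apply: integrable_mulr; exact: momf.2.
  rewrite !RintegralZl//; [|exact: momf.2|exact: (momF N).2].
  have := FK N m; rewrite /L /moment in momfK *.
  move: momfK; lra.
have hcvg : {ae P, forall w, h N w @[N --> \oo] --> 0}.
  move: Ff; apply: filterS => w Fw.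
  by rewrite -(subrr (f w ^+ m)); apply: cvgB; [exact: cvg_exprn|exact: cvg_cst].
have clip0 A : 0 <= A -> \int[P]_w `|clip A (h N w)| @[N --> \oo] --> 0.
  move=> A0.
  have [] := @Rintegral_dominated_cvg _ _ _ P (fun N w => `|clip A (h N w)|)
    (fun=> 0) (fun=> A); last by move=> _; rewrite Rintegral_cst1.
  - move=> N; apply: measurableT_comp => //.
    exact: measurableT_comp (measurable_clip _) (mh N).
  - exact: measurable_cst.
  - move: hcvg; apply: filterS => w hw.
    have := cvg_norm hw; rewrite normr0 => hw'.
    apply: (squeeze_cvgr _ (cvg_cst 0) (hw' _)).
    by apply: nearW => N; rewrite normr_ge0/=; exact: clip_le_norm.
  - exact: integrable_cst.
  - by move=> N w; rewrite normr_id clip_le.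
apply/cvgrPdist_le => e e0.
(* [A] makes L / A at most e / 2, where [L] bounds the integral of h^2; the
   summand 1 keeps it positive. *)
pose A := L / (e / 2) + 1.
have A0 : 0 < A by rewrite ltr_wpDl// divr_ge0// divr_ge0// ltW.
have /cvgrPdist_le/(_ (e / 2)) := clip0 _ (ltW A0).
rewrite divr_gt0// => /(_ isT); apply: filterS => N.
rewrite sub0r normrN => cN; rewrite distrC /moment -RintegralB//; last 2 first.
- exact: (momF N).2.
- exact: momf.2.
have [i2 L2] := ih2 N.
have iclip : P.-integrable setT (EFin \o (fun w => `|clip A (h N w)|)).
  apply: (integrable_le (Y := fun=> A)).
  - apply: measurableT_comp => //.
    exact: measurableT_comp (measurable_clip _) (mh N).
  - exact: integrable_cst.
  - by move=> w; rewrite normr_id clip_le// ltW.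
apply: (@le_trans _ _ (\int[P]_w (`|clip A (h N w)| + A^-1 * h N w ^+ 2))).
  apply: normr_Rintegral_le.
  - exact: ih.
  - by apply: integrable_addr => //; exact: integrable_mulr.
  move=> w; rewrite -/(h N w); have [hA|hA] := leP `|h N w| A.
    by rewrite clip_id// lerDl mulr_ge0 ?sqr_ge0// invr_ge0 ltW.
  apply: ler_wpDl => //; rewrite mulrC ler_pdivlMr// -[h N w ^+ 2]real_normK ?num_real//.
  by rewrite expr2 ler_wpM2l// ltW.
rewrite RintegralD//; last exact: integrable_mulr.
rewrite RintegralZl// (splitr e) lerD//.
  by apply: le_trans cN; exact: ler_norm.
rewrite mulrC ler_pdivrMr//; apply: (le_trans L2).
rewrite /A mulrDr mulr1 mulrCA divff ?mulr1; last by rewrite gt_eqF// divr_gt0.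
by rewrite lerDl divr_ge0// ltW.
Qed.

End moment_limit.

(** * Moments of the superposition and intermittency *)

Section translation.
Context (d : measure_display) (T : measurableType d) (R : realType)
        (P : probability T R).
Implicit Type X : T -> R.

Lemma moment1_alg_cumulant (mu : nat -> R) : mu 0%N = 1 -> alg_cumulant mu 1 = mu 1%N.
Proof.
by move=> mu0; have := alg_cumulantP mu0 0; rewrite bconv0 mu0 mulr1 /shift => ->.
Qed.

(** A constant is independent of everything and has no cumulants of order at
    least 2. *)
Lemma cumulant_translate X (c : R) m : all_moments P X ->
  alg_cumulant (moment P (fun w => X w + c)) m.+2 = alg_cumulant (moment P X) m.+2.
Proof.
move=> hX; have hc := all_moments_cst P c.
rewrite -[RHS]addr0 -(alg_cumulant_exp c (m := m.+2))// -alg_cumulantD ?moment0 ?expr0//.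
apply: eq_alg_cumulant => // [|j _]; first exact: moment0.
rewrite moment_addE//; first by apply: eq_bconv => // k _; exact: moment_cst.
move=> k l; rewrite moment_cst RintegralZr//; exact: hX.2.
Qed.

(** Integrate 2 |X^a X^b| <= s X^(2a) + X^(2b) / s. The parameter [s] balances two
    moments of different orders of magnitude. *)
Lemma even_moment_amgm X a b s : all_moments P X -> 0 < s ->
  2 * `|moment P X (a + b)| <= s * moment P X (a * 2) + s^-1 * moment P X (b * 2).
Proof.
move=> hX s0; have iX := hX.2.
rewrite -[2 * _]ger0_norm ?mulr_ge0// normrM normr_id -normrM.
rewrite /moment -RintegralZl//; last exact: iX.
rewrite -RintegralZl//; last exact: iX.
rewrite -RintegralZl//; last exact: iX.
rewrite -RintegralD//; [|by apply: integrable_mulr; exact: iX..].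
apply: normr_Rintegral_le.
- by apply: integrable_mulr; exact: iX.
- by apply: integrable_addr; apply: integrable_mulr; exact: iX.
move=> w; rewrite normrM ger0_norm// exprD normrM !exprM.
rewrite -[X w ^+ a ^+ 2]real_normK ?num_real// -[X w ^+ b ^+ 2]real_normK ?num_real//.
move: `|X w ^+ a| `|X w ^+ b| => p q.
have : 0 <= s^-1 * (s * p - q) ^+ 2 by rewrite mulr_ge0 ?sqr_ge0// invr_ge0 ltW.
have -> : s^-1 * (s * p - q) ^+ 2 = s * p ^+ 2 + s^-1 * q ^+ 2 - 2 * (p * q).
  by field; rewrite gt_eqF.
by rewrite subr_ge0.
Qed.

End translation.

(** The rates that result from [even_moment_amgm] for moments Ma = O(x^(2a) v^4)
    and Mb = O(x^(2b) v^2). With s = x^(b-a) / v both terms on the right are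
    O(x^(a+b) v^3), whereas a moment of order a + b with a non-zero cumulant is of
    the larger order x^(a+b) v^2. *)
Lemma amgm_rate (R : realType) (x v c B Ba Bb m Ma Mb : R) a b :
  0 < x -> 0 < v -> Ma <= Ba * (x ^+ (a * 2) * v ^+ 2 ^+ 2) ->
  Mb <= Bb * (x ^+ (b * 2) * v ^+ 2) ->
  c * (x ^+ (a + b) * v ^+ 2) - B * (x ^+ (a + b) * v ^+ 2 ^+ 2) <= m ->
  (forall s, 0 < s -> 2 * m <= s * Ma + s^-1 * Mb) ->
  2 * c <= (Ba + Bb) * v + 2 * B * v ^+ 2.
Proof.
move=> x0 v0 HMa HMb Hm Hs.
have xab : x ^+ (a * 2) * x ^+ (b * 2) = x ^+ (a + b) * x ^+ (a + b).
  by rewrite -!exprD -mulnDl muln2 addnn.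
have : 0 < x ^+ (a * 2) by exact: exprn_gt0.
have : 0 < x ^+ (a + b) by exact: exprn_gt0.
move: xab HMa HMb Hm.
move: (x ^+ (a * 2)) (x ^+ (b * 2)) (x ^+ (a + b)) => p q r pq HMa HMb Hm r0 p0.
(* r / (p v) is x^(b-a) / v without a negative exponent. *)
have s0 : 0 < r / (p * v) by rewrite divr_gt0// mulr_gt0.
have T1 : r / (p * v) * Ma <= r * v ^+ 2 * (Ba * v).
  apply: (le_trans (ler_wpM2l (ltW s0) HMa)).
  by rewrite le_eqVlt; apply/orP; left; apply/eqP; field; rewrite !gt_eqF.
have T2 : (r / (p * v))^-1 * Mb <= r * v ^+ 2 * (Bb * v).
  have s1 : 0 <= (r / (p * v))^-1 by rewrite invr_ge0 ltW.
  apply: (le_trans (ler_wpM2l s1 HMb)).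
  rewrite le_eqVlt; apply/orP; left; apply/eqP; rewrite invfM invrK.
  have -> : r^-1 * (p * v) * (Bb * (q * v ^+ 2)) = r^-1 * (p * q) * (Bb * v * v ^+ 2).
    by ring.
  by rewrite pq; field; rewrite gt_eqF.
have T3 := Hs _ s0.
have rv0 : 0 < r * v ^+ 2 by rewrite mulr_gt0 ?exprn_gt0.
rewrite -(ler_pM2l rv0).
have -> : r * v ^+ 2 * (2 * c) = 2 * (c * (r * v ^+ 2)) by ring.
have -> : r * v ^+ 2 * ((Ba + Bb) * v + 2 * B * v ^+ 2) =
  r * v ^+ 2 * (Ba * v) + r * v ^+ 2 * (Bb * v) + 2 * (B * (r * v ^+ 2 ^+ 2)) by ring.
lra.
Qed.

Section scaling.
Context (d : measure_display) (T : measurableType d) (R : realType)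
        (P : probability T R).

(** As t / 2 <= [t] <= t, ln mu_[t] = a ln t + O(1). *)
Lemma scaling_of_power_bounds (Y : R -> T -> R) (mu : nat -> R) (q a c B : R) n0 :
  0 < c -> 0 < B -> (0 < n0)%N ->
  (forall t, (0 < Num.truncn t)%N -> abs_moment P Y q t = (mu (Num.truncn t))%:E) ->
  (forall n, (n0 <= n)%N -> c * n%:R `^ a <= mu n <= B * n%:R `^ a) ->
  scaling_at P Y q a.
Proof.
move=> c0 B0 n00 YE Hmu.
pose K := `|ln c| + `|ln B| + `|a| * ln 2.
have K0 : 0 <= K by rewrite !addr_ge0// mulr_ge0// ln_ge0// ler1n.
have mu_bound t : n0%:R <= t ->
    0 < mu (Num.truncn t) /\ `|ln (mu (Num.truncn t)) - a * ln t| <= K.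
  move=> nt; have t1 : 1 <= t by rewrite (le_trans _ nt)// ler1n.
  have t0 : 0 < t by rewrite (lt_le_trans ltr01).
  have /andP[h1 h2] := truncn_itv (ltW t0).
  have nn0 : (n0 <= Num.truncn t)%N by rewrite truncn_ge_nat// ltW.
  set n := Num.truncn t in h1 h2 nn0 *.
  have n1 : 1 <= n%:R :> R by rewrite ler1n (leq_trans n00).
  have n0' : 0 < n%:R :> R by rewrite (lt_le_trans ltr01).
  have /andP[m1 m2] := Hmu n nn0.
  have p0 : 0 < n%:R `^ a by exact: powR_gt0.
  have m0 : 0 < mu n by apply: lt_le_trans m1; rewrite mulr_gt0.
  split => //.
  have l1 : ln c + a * ln n%:R <= ln (mu n).
    by rewrite -ln_powR -lnM ?posrE// ler_ln ?posrE// mulr_gt0.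
  have l2 : ln (mu n) <= ln B + a * ln n%:R.
    by rewrite -ln_powR -lnM ?posrE// ler_ln ?posrE// mulr_gt0.
  have l3 : `|a * ln n%:R - a * ln t| <= `|a| * ln 2.
    rewrite -mulrBr normrM ler_wpM2l// ler_norml.
    have u1 : ln n%:R <= ln t by rewrite ler_ln ?posrE.
    have u2 : ln t <= ln 2 + ln n%:R.
      rewrite -lnM ?posrE// ler_ln ?posrE ?mulr_gt0//.
      by rewrite (le_trans (ltW h2))// -natr1; lra.
    have u3 : 0 <= ln 2 :> R by rewrite ln_ge0// ler1n.
    by apply/andP; split; lra.
  have c1 := ler_norm (ln c); have c2 := ler_norm (- ln c); rewrite normrN in c2.
  have b1 := ler_norm (ln B); have b2 := ler_norm (- ln B); rewrite normrN in b2.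
  move: l3; rewrite ler_norml => /andP[l3 l4].
  rewrite ler_norml /K; apply/andP; split; lra.
rewrite /scaling_at.
have fE : \forall t \near +oo%R, (lne (abs_moment P Y q t) * ((ln t)^-1)%:E)%E =
    (ln (mu (Num.truncn t)) / ln t)%:E.
  near=> t; have nt : n0%:R <= t by near: t; exact: nbhs_pinfty_ge.
  have [m0 _] := mu_bound t nt.
  rewrite YE ?lne_EFin// truncn_gt0 (le_trans _ nt)// ler1n//.
apply: cvg_EFin; first by apply: filterS fE => t ->.
apply: (cvg_trans (G := ln (mu (Num.truncn t)) / ln t @[t --> +oo%R])).
  by apply: near_eq_cvg; apply: filterS fE => t /= ->.
apply/cvgrPdist_le => e e0; near=> t.
have nt : n0%:R <= t by near: t; exact: nbhs_pinfty_ge.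
have [m0 mK] := mu_bound t nt.
have t1 : expR (K / e + 1) <= t by near: t; exact: nbhs_pinfty_ge.
have lt : K / e + 1 <= ln t.
  by rewrite -[leLHS]expRK ler_ln ?posrE ?expR_gt0// (lt_le_trans (expR_gt0 _) t1).
have lt0 : 0 < ln t by rewrite (lt_le_trans _ lt)// ltr_wpDl// divr_ge0// ltW.
have -> : a - ln (mu (Num.truncn t)) / ln t =
    (a * ln t - ln (mu (Num.truncn t))) / ln t by field; rewrite gt_eqF.
rewrite normrM [`|(ln t)^-1|]ger0_norm ?invr_ge0 ?(ltW lt0)// ler_pdivrMr// distrC.
apply: (le_trans mK); rewrite mulrC -ler_pdivrMr//; lra.
Unshelve. all: by end_near. Qed.

End scaling.

Section superposition_moments.
Context (R : realType) (d : measure_display) (T : measurableType d)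
  (P : probability T R) (lambda alpha : R) (C : nat -> R)
  (Z X : nat -> R -> {RV P >-> R}) (Xinf : R -> {RV P >-> R}).
Hypotheses (lambda0 : 0 < lambda) (alpha0 : 0 < alpha) (alpha1 : alpha < 1).
Hypothesis condA : forall p : nat, (2 <= p)%N ->
  conditionA (fun k => lambda / k.+1%:R)
    (fun k => k.+1%:R `^ (- (1 + alpha))) C Z X p.
Hypothesis condB : conditionB X.
Hypothesis XinfE : is_superposition X Xinf.

Local Notation rho k := (expR (- (lambda / k.+1%:R))).
Local Notation delta k := (k.+1%:R `^ (- (1 + alpha))).
Local Notation rate n := (n%:R `^ (- alpha)).

Lemma all_moments_X k t : 0 <= t -> all_moments P (X k t).
Proof.
move=> t0; have [_ _ _ OU _ _ _ _] := condA (leqnn 2).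
apply: (stationary_all_moments (OU_stationary (OU k))) => // p p2.
exact: condA_moment (condA p2) k.
Qed.

Lemma cumulant_X0 k m :
  alg_cumulant (moment P (X k 0)) m.+2 = C m.+2 * delta k.
Proof.
have := @condA_cumulant _ _ _ _ _ _ _ _ _ _ (condA (isT : (2 <= m.+2)%N)) k m.+2.
rewrite /= leqnn => /(_ isT).
by rewrite cumulantE//; [case|exact: all_moments_X].
Qed.

Definition mean k t : R := fine 'E_P[X k t].

Definition centered_sum n k w : R :=
  \sum_(i < n) (X k i.+1%:R w - mean k i.+1%:R).

Lemma moment1_X k t : moment P (X k t) 1 = mean k t.
Proof.
by rewrite /mean /moment unlock /Rintegral; congr fine.
Qed.

Lemma all_moments_centered k t : 0 <= t ->
  all_moments P (fun w => X k t w - mean k t).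
Proof.
by move=> t0; apply: all_momentsD; [exact: all_moments_X|exact: all_moments_cst].
Qed.

Lemma all_moments_centered_sum n k : all_moments P (centered_sum n k).
Proof. by apply: all_moments_sum => i; exact: all_moments_centered. Qed.

Lemma moment1_centered_sum n k : moment P (centered_sum n k) 1 = 0.
Proof.
have iX (i : 'I_n) : P.-integrable setT
    (EFin \o (fun w => X k i.+1%:R w - mean k i.+1%:R)).
  have := (all_moments_centered k (ler0n R i.+1)).2 1%N.
  by under eq_fun do rewrite expr1.
rewrite /moment; under eq_Rintegral do rewrite expr1.
rewrite (Rintegral_sum _ iX).2 big1// => i _.
have i1 := (all_moments_X k (ler0n R i.+1)).2 1%N.
rewrite RintegralB//; last exact: integrable_cst.
rewrite Rintegral_cst1 -moment1_X /moment.
by under [X in _ - X]eq_Rintegral do rewrite expr1; rewrite subrr.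
Qed.

Lemma cumulant_centered_sum n k m :
  alg_cumulant (moment P (centered_sum n k)) m.+2 =
  C m.+2 * (delta k * OU_weight m.+2 (rho k) n).
Proof.
have [_ _ _ OU _ _ _ _] := condA (leqnn 2).
have -> : centered_sum n k = fun w => (\sum_(i < n) X k i.+1%:R w) +
    (- \sum_(i < n) mean k i.+1%:R).
  by apply/funext => w; rewrite /centered_sum sumrB.
rewrite cumulant_translate; last by apply: all_moments_sum => i; exact: all_moments_X.
have lk : 0 < lambda / k.+1%:R by rewrite divr_gt0// ltr0n.
rewrite (OU_partial_sum_cumulant lk (OU k))//; last by move=> t; exact: all_moments_X.
by rewrite cumulant_X0 mulrA.
Qed.

Definition partial_superposition n N w : R :=
  \sum_(0 <= k < N) centered_sum n k w.

Lemma all_moments_partial n N : all_moments P (partial_superposition n N).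
Proof. by apply: all_moments_sum => k; exact: all_moments_centered_sum. Qed.

Lemma moment1_partial n N : moment P (partial_superposition n N) 1 = 0.
Proof.
have iV k : P.-integrable setT (EFin \o centered_sum n k).
  have := (all_moments_centered_sum n k).2 1%N.
  by under eq_fun do rewrite expr1.
rewrite /moment; under eq_Rintegral do rewrite expr1.
rewrite (Rintegral_sum _ iV).2 big1// => k _.
rewrite -(moment1_centered_sum n k) /moment.
by apply: eq_Rintegral => ? _; rewrite expr1.
Qed.

Lemma centered_sum_process n k : sigma_rv (centered_sum n k) `<=` sigma_process (X k).
Proof.
move=> _ [B mB <-].
pose G := \bigcup_(t in [set t : R | 0 <= t]) sigma_rv (X k t).
have mG : gen_measurable G (centered_sum n k).
  apply: measurable_sum => i; apply: measurable_funB; last exact: measurable_cst.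
  move=> _ B' mB'; rewrite setTI; apply: sub_sigma_algebra.
  by exists i.+1%:R; [exact: ler0n|exists B'].
by have := mG measurableT B mB; rewrite setTI.
Qed.

(** The cumulants of independent summands add up. *)
Lemma cumulant_partial n N m :
  alg_cumulant (moment P (partial_superposition n N)) m.+2 =
  C m.+2 * \sum_(0 <= k < N) delta k * OU_weight m.+2 (rho k) n.
Proof.
have [_ _ _ _ indX _ _ _] := condA (leqnn 2).
elim: N => [|N IH].
  rewrite big_geq// mulr0 -[RHS](alg_cumulant_exp (0 : R) (m := m.+2))//.
  apply: eq_alg_cumulant => //; first exact: moment0.
  move=> j _; rewrite -(moment_cst P 0 j); congr (moment P _ j).
  by apply/funext => w; rewrite /partial_superposition big_geq.
rewrite big_nat_recr//= mulrDr -IH -cumulant_centered_sum.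
rewrite -cumulantD_indep//.
- congr (alg_cumulant (moment P _) _).
  by apply/funext => w; rewrite /partial_superposition big_nat_recr.
- exact: all_moments_partial.
- exact: all_moments_centered_sum.
- apply: indep_rv_approximable; first exact: (all_moments_centered_sum n N).1.
  apply: (independent_sum (H := fun k => \bigcup_(t in [set t : R | 0 <= t]) sigma_rv (X k t))).
  + by move=> k; exact: sigma_process_measurable.
  + exact: indX.
  + by move=> k; exact: centered_sum_process.
Qed.

(** [moments_le_of_cumulants] with x = n and e = n^(- alpha). The constants do not
    depend on the number [N] of processes. *)
Lemma partial_moment_bounds m : exists2 B : R, 0 <= B &
  forall n N j, (0 < n)%N -> (0 < j <= m)%N ->
  `|moment P (partial_superposition n N) j| <= B * (n%:R ^+ j * rate n) /\
  `|moment P (partial_superposition n N) j -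
    alg_cumulant (moment P (partial_superposition n N)) j| <=
     B * (n%:R ^+ j * rate n ^+ 2).
Proof.
pose a m' := sval (cid2 (OU_weight_sum_le lambda0 alpha0 alpha1 m')).
have a0 m' : 0 <= a m' by rewrite /a; case: cid2.
have aP m' n N : (0 < n)%N ->
    \sum_(0 <= k < N) delta k * OU_weight m'.+2 (rho k) n <= a m' * (n%:R ^+ m'.+2 * rate n).
  by move=> n0; rewrite /a; case: cid2 => /= ? ?; exact.
(* The sums are centered, so that their cumulant of order 1 is 0. *)
pose A j := if j is m'.+2 then `|C j| * a m' else 0.
have A0 j : 0 <= A j by case: j => [|[|j]] //=; rewrite mulr_ge0.
have [B B0 HB] := moments_le_of_cumulants m A0.
exists B => // n N j n0 jm; apply: (HB n%:R (rate n) _ _ _ _ _ _ _ _ j jm) => //.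
- by rewrite -[leRHS](powRr0 n%:R) ler_powR ?ler1n// oppr_le0 ltW.
- exact: moment0.
- exact: alg_cumulantP (moment0 _ _).
move=> [|[|i]] // _.
  by rewrite moment1_alg_cumulant ?moment0// moment1_partial normr0 mul0r.
rewrite cumulant_partial /A normrM -mulrA ler_wpM2l// ger0_norm ?aP//.
by apply: sumr_ge0 => k _; rewrite mulr_ge0 ?powR_ge0// OU_weight_ge0 ?decay_gt0// decay_lt1.
Qed.

Definition limit_mean t : R := limn (series (fun k => mean k t)).

Definition limit_sum n w : R :=
  \sum_(i < n) (Xinf i.+1%:R w - limit_mean i.+1%:R).

Lemma partial_superposition_cvg n :
  {ae P, forall w, partial_superposition n N w @[N --> \oo] --> limit_sum n w}.
Proof.
have /ae_foralln : forall i : nat, {ae P, forall w,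
    series (fun k => X k i.+1%:R w) N @[N --> \oo] --> Xinf i.+1%:R w}.
  by move=> i; apply: XinfE.
apply: filterS => w Xw.
have -> : (fun N => partial_superposition n N w) = fun N => \sum_(i < n)
    (series (fun k => X k i.+1%:R w) N - series (fun k => mean k i.+1%:R) N).
  apply/funext => N; rewrite /partial_superposition exchange_big.
  by apply: eq_bigr => i _; rewrite sumrB.
rewrite /limit_sum; elim: n => [|n IH].
  under eq_fun do rewrite big_ord0; rewrite big_ord0; exact: cvg_cst.
under eq_fun do rewrite big_ord_recr; rewrite big_ord_recr /=.
apply: cvgD IH _; apply: cvgB; first exact: Xw.
by have [+ _] := condB (ler0n R n.+1).
Qed.

Lemma measurable_limit_sum n : measurable_fun setT (limit_sum n).
Proof.
by apply: measurable_sum => i; apply: measurable_funB => //; exact: measurable_cst.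
Qed.

(** The moments of even order are bounded in [N], as [moment_cvg] requires. *)
Lemma limit_sum_moments n : (0 < n)%N -> all_moments P (limit_sum n) /\
  forall m, moment P (partial_superposition n N) m @[N --> \oo] -->
    moment P (limit_sum n) m.
Proof.
move=> n0.
pose B m := sval (cid2 (partial_moment_bounds m)).
pose K j := 1 + B (j * 2)%N * (n%:R ^+ (j * 2) * rate n).
have FK N j : moment P (partial_superposition n N) (j * 2) <= K j.
  rewrite /K /B; case: cid2 => /= b b0 Hb; case: j Hb => [|j] Hb.
    by rewrite mul0n moment0 lerDl !mulr_ge0 ?powR_ge0.
  have [+ _] := Hb n N (j.+1 * 2)%N n0 (leqnn _).
  by move=> /(le_trans (ler_norm _)) /le_trans; apply; rewrite lerDr.
split.
  exact: (limit_all_moments (all_moments_partial n) (measurable_limit_sum n)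
    (partial_superposition_cvg n) FK).
exact: (moment_cvg (all_moments_partial n) (measurable_limit_sum n)
    (partial_superposition_cvg n) FK).
Qed.

Lemma limit_moment_le j : (0 < j)%N -> exists2 B : R, 0 <= B & forall n,
  (0 < n)%N -> `|moment P (limit_sum n) j| <= B * (n%:R ^+ j * rate n).
Proof.
move=> j0; have [B B0 HB] := partial_moment_bounds j; exists B => // n n0.
have [_ /(_ j) cv] := limit_sum_moments n0.
apply: (cvgr_to_le (cvg_norm cv)).
by apply: nearW => N; apply: (HB n N j n0 _).1; rewrite j0 leqnn.
Qed.

(** When the leading term vanishes, the moment gains a second factor
    n^(- alpha). *)
Lemma limit_moment_cumulant0_le j : (2 <= j)%N -> C j = 0 ->
  exists2 B : R, 0 <= B & forall n,
  (0 < n)%N -> `|moment P (limit_sum n) j| <= B * (n%:R ^+ j * rate n ^+ 2).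
Proof.
case: j => [|[|j]]// _ Cj; have [B B0 HB] := partial_moment_bounds j.+2.
exists B => // n n0; have [_ /(_ j.+2) cv] := limit_sum_moments n0.
apply: (cvgr_to_le (cvg_norm cv)).
apply: nearW => N; have [_] := HB n N j.+2 n0 (leqnn _).
by rewrite cumulant_partial Cj mul0r subr0.
Qed.

Lemma limit_moment_ge j : (2 <= j)%N -> C j != 0 -> exists c B : R, [/\ 0 < c, 0 <= B &
  forall n, (0 < n)%N -> c * (n%:R ^+ j * rate n) - B * (n%:R ^+ j * rate n ^+ 2) <=
    `|moment P (limit_sum n) j|].
Proof.
case: j => [|[|j]]// _ Cj; have [B B0 HB] := partial_moment_bounds j.+2.
have [c c0 Hc] := OU_weight_sum_ge lambda0 alpha0 alpha1 j.+1.
exists (`|C j.+2| * c), B; split => // [|n n0]; first by rewrite mulr_gt0 ?normr_gt0.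
have [_ /(_ j.+2) cv] := limit_sum_moments n0.
apply: (cvgr_to_ge (cvg_norm cv)).
exists (n + n)%N => // N /= nN.
have [_] := HB n N j.+2 n0 (leqnn _); rewrite cumulant_partial.
have := Hc n N n0 nN.
set S := \sum_(0 <= k < N) _ => HS.
have S0 : 0 <= S.
  by apply: le_trans HS; rewrite mulr_ge0 ?(ltW c0)// mulr_ge0 ?powR_ge0.
set m := moment _ _ _ => Hm.
have h2 : `|C j.+2| * c * (n%:R ^+ j.+2 * rate n) <= `|C j.+2 * S|.
  by rewrite normrM (ger0_norm S0) -mulrA ler_wpM2l.
rewrite lerBlDr (le_trans h2)// -[X in `|X| <= _](subrK m) addrC.
by rewrite (le_trans (ler_normD _ _))// lerD2l distrC.
Qed.

Lemma powR_rate_small (e : R) : 0 < e ->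
  exists2 n0, (0 < n0)%N & forall n, (n0 <= n)%N -> rate n <= e.
Proof.
move=> e0; pose y := (e^-1) `^ alpha^-1.
exists (Num.bound y).+1 => // n yn.
have n0 : 0 < n%:R :> R by rewrite ltr0n (leq_trans _ yn).
have y0 : 0 <= y by exact: powR_ge0.
have yn' : y <= n%:R.
  by apply: (le_trans (ltW (archi_boundP y0))); rewrite ler_nat (leq_trans _ yn).
rewrite powRN -[leRHS]invrK lef_pV2 ?posrE ?invr_gt0 ?powR_gt0//.
have -> : e^-1 = y `^ alpha.
  by rewrite /y -powRrM mulVf ?gt_eqF// powRr1// invr_ge0 ltW.
by rewrite ge0_ler_powR ?nnegrE ?(ltW alpha0) ?(ltW n0).
Qed.

(** [amgm_rate] with x = n and v = n^(- alpha / 2). If C_(a+b) were not 0, it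
    would bound a positive constant by a multiple of v, which tends to 0. *)
Lemma cumulant_coef_eq0 a b : (0 < a)%N -> (0 < b)%N ->
  C (a * 2)%N = 0 -> C (a + b)%N = 0.
Proof.
move=> a0 b0 Ca; apply/eqP; apply: contraT => Cj; set j := (a + b)%N in Cj *.
have j2 : (2 <= j)%N by rewrite /j -(addn1 1) leq_add.
have [c [B [c0 B0 Hc]]] := limit_moment_ge j2 Cj.
have a2 : (2 <= a * 2)%N by rewrite -{1}[2%N]mul1n leq_pmul2r.
have [Ba Ba0 Ha] := limit_moment_cumulant0_le a2 Ca.
have b2 : (0 < b * 2)%N by rewrite muln_gt0 b0.
have [Bb Bb0 Hb] := limit_moment_le b2.
pose D := Ba + Bb + 2 * B + 1.
have D0 : 0 < D by rewrite ltr_wpDl// !addr_ge0// mulr_ge0.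
(* For v <= 1 and v <= c / D the bound 2 c <= (Ba + Bb) v + 2 B v^2 <= D v fails. *)
pose e := Num.min 1 (c / D).
have e0 : 0 < e by rewrite lt_min ltr01 divr_gt0.
have [n n0 /(_ n (leqnn _)) we] := powR_rate_small (exprn_gt0 2 e0).
have x0 : 0 < n%:R :> R by rewrite ltr0n.
have [momY _] := limit_sum_moments n0.
have w0 : 0 < rate n by exact: powR_gt0.
pose v := Num.sqrt (rate n).
have v0 : 0 < v by rewrite sqrtr_gt0.
have v2 : v ^+ 2 = rate n by rewrite sqr_sqrtr// ltW.
have ve : v <= e.
  by rewrite -(@ler_pXn2r _ 2) ?nnegrE ?(ltW v0) ?(ltW e0)// v2.
have {}Ha := Ha n n0; have {}Hb := Hb n n0; have {}Hc := Hc n n0.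
rewrite -v2 in Ha Hb Hc.
have := amgm_rate x0 v0 (le_trans (ler_norm _) Ha) (le_trans (ler_norm _) Hb) Hc
  (fun s s0 => even_moment_amgm a b momY s0).
have v1 : v <= 1 by rewrite (le_trans ve)// ge_min lexx.
have vD : D * v <= c.
  by rewrite mulrC -ler_pdivlMr// (le_trans ve)// ge_min lexx orbT.
have vv : v ^+ 2 <= v by rewrite expr2 ler_piMl// ltW.
have := ler_wpM2l B0 vv; rewrite /D in vD; move=> h1 h2.
have : c + c <= c.
  apply: le_trans vD; have : 0 < v := v0; move: h1 h2.
  set Bv := B * v; set Bv2 := B * v ^+ 2.
  rewrite -[2 * B * v ^+ 2]mulrA -/Bv2.
  have -> : (Ba + Bb + 2 * B + 1) * v = (Ba + Bb) * v + 2 * Bv + v by rewrite /Bv; ring.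
  lra.
by rewrite gerDl leNgt c0.
Qed.

Lemma even_limit_moment_bounds M : (2 <= M)%N -> ~~ odd M -> C M != 0 ->
  exists c B n0, [/\ 0 < c, 0 < B, (0 < n0)%N & forall n, (n0 <= n)%N ->
    c * (n%:R ^+ M * rate n) <= moment P (limit_sum n) M <= B * (n%:R ^+ M * rate n)].
Proof.
move=> M2 oM CM; have [c [B [c0 B0 Hc]]] := limit_moment_ge M2 CM.
have [B' B'0 HB'] := limit_moment_le (ltnW M2).
have e0 : 0 < c / (2 * (B + 1)) by rewrite divr_gt0// mulr_gt0// ltr_wpDl.
have [n0 n00 Hw] := powR_rate_small e0.
exists (c / 2), (B' + 1), n0; split => // [||n nn0]; rewrite ?divr_gt0 ?ltr_wpDl//.
have n1 : (0 < n)%N := leq_trans n00 nn0.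
have x0 : 0 < n%:R :> R by rewrite ltr0n.
have w0 : 0 < rate n by exact: powR_gt0.
have xM : 0 <= n%:R ^+ M * rate n by rewrite mulr_ge0 ?exprn_ge0 ?ltW.
have mE : `|moment P (limit_sum n) M| = moment P (limit_sum n) M.
  rewrite ger0_norm//; apply: Rintegral_ge0 => w _.
  by rewrite -(even_halfK oM) -muln2 exprM sqr_ge0.
apply/andP; split; last first.
  rewrite -mE (le_trans (HB' n n1))// ler_wpM2r// lerDl//.
rewrite -mE; apply: le_trans (Hc n n1).
have : B * rate n <= c / 2.
  have := Hw n nn0; rewrite invfM mulrA ler_pdivlMr ?ltr_wpDl// => h.
  by apply: le_trans h; rewrite mulrC ler_wpM2l ?(ltW w0)// lerDl.
move=> /(ler_wpM2l xM).
have -> : n%:R ^+ M * rate n ^+ 2 = n%:R ^+ M * rate n * rate n by rewrite expr2 mulrA.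
lra.
Qed.

(** The first moments pass to the limit as well, so that the centering of the
    superposition is the sum of the centerings of its components. *)
Lemma centered_partial_sumE t :
  centered P (partial_sum Xinf) t = limit_sum (Num.truncn t).
Proof.
set n := Num.truncn t.
pose L := \sum_(i < n) limit_mean i.+1%:R.
have SE : partial_sum Xinf t = fun w => limit_sum n w + L.
  apply/funext => w; rewrite /partial_sum /limit_sum sumrB subrK.
  by rewrite big_add1 /= big_mkord.
have EL : fine 'E_P[partial_sum Xinf t] = L.
  (* For t < 1 the sum is empty and the bounds on moments say nothing. *)
  rewrite SE; case: (posnP n) => [n0|n0].
    rewrite unlock -/(Rintegral P setT (fun w => limit_sum n w + L)).
    rewrite [LHS](_ : _ = \int[P]_w L); first exact: Rintegral_cst1.
    by apply: eq_Rintegral => w _; rewrite /limit_sum n0 big_ord0 add0r.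
  have [momY cv] := limit_sum_moments n0.
  have i1 := momY.2 1%N.
  rewrite unlock -/(Rintegral P setT (fun w => limit_sum n w + L)).
  rewrite RintegralD//; last exact: integrable_cst.
  rewrite Rintegral_cst1 -[RHS]add0r; congr (_ + _).
  have := cv 1%N; rewrite (_ : (fun N => _) = fun=> 0); last first.
    by apply/funext => N; exact: moment1_partial.
  by move=> cv0; apply: (cvg_unique _ cv0) => //; exact: cvg_cst.
by apply/funext => w; rewrite /centered EL SE addrK.
Qed.

Lemma abs_moment_centered t M : ~~ odd M -> (0 < Num.truncn t)%N ->
  abs_moment P (centered P (partial_sum Xinf)) M%:R t =
  (moment P (limit_sum (Num.truncn t)) M)%:E.
Proof.
move=> oM n0; have [momY _] := limit_sum_moments n0.
rewrite /abs_moment centered_partial_sumE unlock /moment /Rintegral fineK; last first.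
  by apply: integrable_fin_num => //; exact: momY.2.
apply: eq_integral => w _; rewrite powR_mulrn//.
by rewrite -(even_halfK oM) -muln2 mulnC !exprM real_normK ?num_real.
Qed.

Lemma scaling_even M : (2 <= M)%N -> ~~ odd M -> C M != 0 ->
  scaling_at P (centered P (partial_sum Xinf)) M%:R (M%:R - alpha).
Proof.
move=> M2 oM CM; have [c [B [n0 [c0 B0 n00 Hm]]]] := even_limit_moment_bounds M2 oM CM.
apply: (scaling_of_power_bounds (mu := fun n => moment P (limit_sum n) M) c0 B0 n00)
  => [t nt|n nn0].
  exact: abs_moment_centered.
have n0' : 0 < n%:R :> R by rewrite ltr0n (leq_trans n00).
have -> : n%:R `^ (M%:R - alpha) = n%:R ^+ M * rate n.
  by rewrite powRD ?powR_mulrn// (gt_eqF n0') implybT.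
exact: Hm.
Qed.

(** All even moments of all partial sums are finite. *)
Lemma qbar_centered (q : R) : (q%:E < qbar P (centered P (partial_sum Xinf)))%E.
Proof.
pose M := ((Num.bound `|q|).+1 * 2)%N.
have qM : q < M%:R.
  apply: (le_lt_trans (ler_norm _)); apply: (lt_le_trans (archi_boundP _)) => //.
  by rewrite ler_nat /M muln2 -addnn (leq_trans (leqnSn _))// leq_addr.
have oM : ~~ odd M by rewrite /M muln2 odd_double.
apply: (@lt_le_trans _ _ M%:R%:E); first by rewrite lte_fin.
apply: ereal_sup_ubound; exists M%:R => //; split; first by rewrite ltr0n.
move=> t t0; case: (posnP (Num.truncn t)) => [n0|n0]; last first.
  by rewrite abs_moment_centered// ltry.
rewrite /abs_moment centered_partial_sumE n0 unlock.
rewrite (eq_integral (fun=> 0%E)) ?integral0 ?ltry// => w _.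
by rewrite /limit_sum big_ord0 normr0 powR0// pnatr_eq0.
Qed.

(** For odd [m], write m = (m + 1) / 2 + (m - 1) / 2 and use
    [cumulant_coef_eq0]. *)
Lemma exists_even_cumulant m : (3 <= m)%N -> C m != 0 ->
  exists M, [/\ (4 <= M)%N, ~~ odd M & C M != 0].
Proof.
move=> m3 Cm; have [om|om] := boolP (odd m); last first.
  exists m; split => //; rewrite ltn_neqAle m3 andbT.
  by apply: contraNneq om => <-.
exists m.+1; split; rewrite //= ?om//.
apply: contraNneq Cm => Cm1; rewrite -(odd_double_half m) om -addnn add1n -addSn.
apply/eqP/cumulant_coef_eq0 => //; first by rewrite half_gt0 (leq_trans _ m3).
by rewrite -Cm1; congr C; rewrite muln2 doubleS -[in RHS](odd_double_half m) om.
Qed.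

(** M = 1 + (M - 1) in [cumulant_coef_eq0]. *)
Lemma second_cumulant_neq0 M : (4 <= M)%N -> C M != 0 -> C 2 != 0.
Proof.
move=> M4; apply: contra_neq => C2; rewrite -(subnKC (ltnW (ltnW M4))) /=.
have -> : (2 + (M - 2) = 1 + (M - 1))%N by lia.
by apply: cumulant_coef_eq0 => //; lia.
Qed.

Lemma intermittent_superposition m : (3 <= m)%N -> C m != 0 ->
  intermittent P (centered P (partial_sum Xinf)).
Proof.
move=> m3 Cm; have [M [M4 oM CM]] := exists_even_cumulant m3 Cm.
exists 2%:R, M%:R, (2%:R - alpha), (M%:R - alpha); split.
- by rewrite ltr0n ltr_nat (leq_trans _ M4).
- exact: qbar_centered.
- by apply: scaling_even => //; exact: second_cumulant_neq0 CM.
- by apply: scaling_even => //; rewrite (leq_trans _ M4).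
have M0 : 0 < M%:R :> R by rewrite ltr0n (leq_trans _ M4).
have M2 : 2 < M%:R :> R by rewrite ltr_nat (leq_trans _ M4).
rewrite !mulrBl !divff ?gt_eqF// ltrD2l ltrN2 ltr_pM2l//.
by rewrite ltf_pV2 ?posrE.
Qed.

End superposition_moments.

Theorem corollary1 (R : realType) (d : measure_display) (T : measurableType d)
    (P : probability T R) (lambda H : R) (C : nat -> R)
    (Z X : nat -> R -> {RV P >-> R}) (Xinf : R -> {RV P >-> R})
    (lambda_gt0 : 0 < lambda) (H_range : 2^-1 < H < 1)
    (condA : forall p : nat, (2 <= p)%N ->
      conditionA (fun k => lambda / k.+1%:R)
        (fun k => k.+1%:R `^ (- (1 + 2 * (1 - H)))) C Z X p)
    (nongaussian : exists2 m : nat, (3 <= m)%N & C m != 0)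
    (condB : conditionB X)
    (XinfE : is_superposition X Xinf) :
  intermittent P (centered P (partial_sum Xinf)).
Proof.
have [m m3 Cm] := nongaussian; have /andP[H1 H2] := H_range.
have a0 : 0 < 2 * (1 - H) by rewrite mulr_gt0// subr_gt0.
have a1 : 2 * (1 - H) < 1 by lra.
exact: (intermittent_superposition lambda_gt0 a0 a1 condA condB XinfE m3 Cm).
Qed.
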